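(* Let $(\mathcal C,\mathsf d_{\mathcal C})$ be the cone, with apex $\boldsymbol 0$, over a geodesic metric space $(\mathcal X,\mathsf d_{\mathcal X})$, and let $m\in\mathbb N$. Then: (a) If $(\mathcal C,\mathsf d_{\mathcal C})$ satisfies $m$-LAC at $z_0=[x_0,r_0]$ for some $x_0\in\mathcal X$ and $r_0>0$, then $(\mathcal X,\mathsf d_{\mathcal X})$ satisfies $m$-LAC at $x_0$. (b) Conversely, if $(\mathcal X,\mathsf d_{\mathcal X})$ satisfies $m$-LAC at $x_0$, then $(\mathcal C,\mathsf d_{\mathcal C})$ satisfies $m$-LAC at $z_0=[x_0,r_0]$ for every $r_0>0$. (c) $(\mathcal C,\mathsf d_{\mathcal C})$ satisfies $3$-LAC at the apex $\boldsymbol 0$ if and only if $(\mathcal X,\mathsf d_{\mathcal X})$ has perimeter less than or equal to $2\pi$. (d) If $(\mathcal X,\mathsf d_{\mathcal X})$ has diameter less than or equal to $\pi/2$, then $(\mathcal C,\mathsf d_{\mathcal C})$ satisfies $m$-LAC at $\boldsymbol 0$ for all $m\in\mathbb N$.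
   Context: The cone $\mathcal C$ over $(\mathcal X,\mathsf d_{\mathcal X})$ is the quotient of $\mathcal X\times[0,\infty)$ obtained by identifying all points of $\mathcal X\times\{0\}$ with one point $\boldsymbol 0$ (the apex); $[x,r]$ is the class of $(x,r)$, and $\mathsf d_{\mathcal C}^2([x_0,r_0],[x_1,r_1])=r_0^2+r_1^2-2r_0r_1\cos(\min\{\pi,\mathsf d_{\mathcal X}(x_0,x_1)\})$. For two (constant-speed, non-trivial) geodesics $\boldsymbol y_{01},\boldsymbol y_{02}$ in a metric space $(Y,\mathsf d)$ emanating from the same point $y_0$, the upper angle $\angle_{\mathrm{up}}(\boldsymbol y_{01},\boldsymbol y_{02})\in[0,\pi]$ is $$\angle_{\mathrm{up}}(\boldsymbol y_{01},\boldsymbol y_{02})=\limsup_{s,t\downarrow0}\arccos\frac{\mathsf d^2(y_0,\boldsymbol y_{01}(s))+\mathsf d^2(y_0,\boldsymbol y_{02}(t))-\mathsf d^2(\boldsymbol y_{01}(s),\boldsymbol y_{02}(t))}{2\,\mathsf d(y_0,\boldsymbol y_{01}(s))\,\mathsf d(y_0,\boldsymbol y_{02}(t))}.$$ $(Y,\mathsf d)$ satisfies $m$-LAC (local angle condition) at $y_0$ if for every choice of $m$ non-trivial geodesics $\boldsymbol y_{0i}$ starting at $y_0$ and positive reals $b_i$, $i=1,\dots,m$, one has $\sum_{i,j=1}^mb_ib_j\cos(\angle_{\mathrm{up}}(\boldsymbol y_{0i},\boldsymbol y_{0j}))\ge0$. ''Perimeter less than or equal to $2\pi$'' means that $\mathsf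 d_{\mathcal X}(x_1,x_2)+\mathsf d_{\mathcal X}(x_2,x_3)+\mathsf d_{\mathcal X}(x_3,x_1)\le2\pi$ for all pairwise different $x_1,x_2,x_3\in\mathcal X$. *)

(* Defs.v *)
From HB Require Import structures.
From mathcomp Require Import all_boot all_order all_algebra generic_quotient.
From mathcomp Require Import all_classical all_reals all_analysis.
From mathcomp Require Import ring lra.

Set Implicit Arguments.
Unset Strict Implicit.
Unset Printing Implicit Defensive.

Import Order.TTheory GRing.Theory Num.Theory.
Import numFieldNormedType.Exports.

Local Open Scope classical_set_scope.
Local Open Scope ring_scope.
Local Open Scope quotient_scope.

Section metric_notions.
Context {R : realType} (Y : metricType R).
Implicit Types (y : R -> Y) (p : Y).

(* Curves are parametrized by [0, 1]; since they are represented by total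
   functions R -> Y, their values outside [0, 1] are irrelevant. *)
Definition is_geodesic y : Prop :=
  forall s t : R, 0 <= s <= 1 -> 0 <= t <= 1 ->
    mdist (y s) (y t) = `|s - t| * mdist (y 0) (y 1).

Definition geodesic_space : Prop :=
  forall p q : Y, exists y, [/\ is_geodesic y, y 0 = p & y 1 = q].

Definition nontrivial_geodesic_from p y : Prop :=
  [/\ is_geodesic y, y 0 = p & y 0 <> y 1].

Definition comparison_angle p q1 q2 : R :=
  acos ((mdist p q1 ^+ 2 + mdist p q2 ^+ 2 - mdist q1 q2 ^+ 2) /
        (2 * mdist p q1 * mdist p q2)).

(* The limsup is taken in the extended reals. For non-trivial geodesics it is
   the limsup of a function with values in [0, pi], so [fine] loses nothing. *)
Definition upper_angle (y1 y2 : R -> Y) : R :=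
  fine (limf_esup
    (fun st : R * R => (comparison_angle (y1 0) (y1 st.1) (y2 st.2))%:E)
    (filter_prod (0 : R)^'+ (0 : R)^'+)).

Definition LAC (m : nat) p : Prop :=
  forall (y : 'I_m -> R -> Y) (b : 'I_m -> R),
    (forall i, nontrivial_geodesic_from p (y i)) ->
    (forall i, 0 < b i) ->
    0 <= \sum_(i < m) \sum_(j < m)
           b i * b j * cos (upper_angle (y i) (y j)).

Definition perimeter_le (l : R) : Prop :=
  forall x1 x2 x3 : Y, x1 <> x2 -> x2 <> x3 -> x1 <> x3 ->
    mdist x1 x2 + mdist x2 x3 + mdist x3 x1 <= l.

Definition diameter : \bar R :=
  ereal_sup [set (mdist pq.1 pq.2)%:E | pq in [set: Y * Y]].

End metric_notions.

Section cone.
Context {R : realType} (X : metricType R).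
Implicit Types (p q : X * {nonneg R}) (x y : X) (r s : {nonneg R}).

Definition cone_rel p q : bool :=
  (p == q) || (p.2%:num == 0) && (q.2%:num == 0).

Lemma cone_rel_equiv : equiv_class_of cone_rel.
Proof.
split => [p|p q|p q u]; rewrite /cone_rel ?eqxx//.
  by rewrite eq_sym andbC.
case/orP => [/eqP->//|/andP[q0 p0]].
by case/orP => [/eqP<-|/andP[_ u0]]; rewrite ?q0 ?p0 ?u0 ?orbT.
Qed.

Canonical cone_equiv := EquivRelPack cone_rel_equiv.

Definition cone := {eq_quot cone_equiv}.

HB.instance Definition _ := Choice.on cone.

Definition cone_pt x r : cone := \pi_{eq_quot cone_equiv} (x, r).

Lemma cone_ptP x y r s :
  cone_pt x r = cone_pt y s <->
  (x = y /\ r = s) \/ (r%:num = 0 /\ s%:num = 0).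
Proof.
split.
  move/eqmodP; rewrite /= /cone_rel/= => /orP[/eqP[-> ->]|/andP[/eqP ? /eqP ?]].
    by left.
  by right.
move=> H; apply/eqmodP; rewrite /= /cone_rel/=.
by case: H => [[-> ->]|[-> ->]]; rewrite !eqxx ?orbT.
Qed.

(* The base point only witnesses that X is nonempty, see [apexE]. *)
Definition apex (x : X) : cone := cone_pt x 0%:nng.

Lemma apexE x y : apex x = apex y.
Proof. by apply/cone_ptP; right. Qed.

Lemma cone_pt_surj (z : cone) : exists x r, z = cone_pt x r.
Proof.
exists (repr z).1, (repr z).2.
by rewrite /cone_pt -surjective_pairing reprK.
Qed.

Definition cone_pre_dist p q : R :=
  Num.sqrt (p.2%:num ^+ 2 + q.2%:num ^+ 2
            - 2 * p.2%:num * q.2%:num * cos (Num.min pi (mdist p.1 q.1))).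

Definition cone_dist (z w : cone) : R := cone_pre_dist (repr z) (repr w).

Lemma cone_pre_dist_sym p q : cone_pre_dist p q = cone_pre_dist q p.
Proof.
by rewrite /cone_pre_dist metric_sym; congr (Num.sqrt _); ring.
Qed.

Lemma cone_pre_distl p q u : cone_rel p q -> cone_pre_dist p u = cone_pre_dist q u.
Proof.
case/orP => [/eqP->//|/andP[/eqP p0 /eqP q0]].
by rewrite /cone_pre_dist p0 q0 !(mulr0, mul0r).
Qed.

Lemma cone_distE x y r s :
  cone_dist (cone_pt x r) (cone_pt y s) =
  Num.sqrt (r%:num ^+ 2 + s%:num ^+ 2
            - 2 * r%:num * s%:num * cos (Num.min pi (mdist x y))).
Proof.
have E u : cone_rel (repr (\pi_{eq_quot cone_equiv} u)) u.
  by apply/(@eqmodP _ cone_equiv); rewrite reprK.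
rewrite /cone_dist /cone_pt (cone_pre_distl _ (E _)) cone_pre_dist_sym.
by rewrite (cone_pre_distl _ (E _)) cone_pre_dist_sym.
Qed.

Lemma cone_pre_distE_ge0 r s (a : R) :
  0 <= r%:num ^+ 2 + s%:num ^+ 2 - 2 * r%:num * s%:num * cos a.
Proof.
have -> : r%:num ^+ 2 + s%:num ^+ 2 - 2 * r%:num * s%:num * cos a =
  (r%:num - s%:num) ^+ 2 + 2 * (r%:num * s%:num) * (1 - cos a) by ring.
by rewrite addr_ge0 ?sqr_ge0// mulr_ge0 ?subr_ge0 ?cos_le1// !mulr_ge0.
Qed.

Lemma cone_distxx (z : cone) : cone_dist z z = 0.
Proof.
rewrite /cone_dist /cone_pre_dist mdistxx (min_idPr _) ?pi_ge0// cos0.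
by apply/eqP; rewrite sqrtr_eq0 le_eqVlt; apply/orP; left; apply/eqP; ring.
Qed.

Lemma cone_dist_sym (z w : cone) : cone_dist z w = cone_dist w z.
Proof. exact: cone_pre_dist_sym. Qed.

Lemma cone_dist_positivity (z w : cone) : cone_dist z w = 0 -> z = w.
Proof.
have [x [r ->]] := cone_pt_surj z; have [y [s ->]] := cone_pt_surj w.
rewrite cone_distE; set a := Num.min _ _ => /eqP; rewrite sqrtr_eq0 => le0.
have rs0 : 0 <= r%:num * s%:num by rewrite mulr_ge0.
have ca : 0 <= 1 - cos a by rewrite subr_ge0 cos_le1.
have t0 := mulr_ge0 rs0 ca.
have q0 := sqr_ge0 (r%:num - s%:num).
have /eqP : (r%:num - s%:num) ^+ 2 = 0.
  by apply/eqP; rewrite eq_le q0 andbT; nra.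
rewrite sqrf_eq0 subr_eq0 => /eqP rs.
have /eqP : r%:num * s%:num * (1 - cos a) = 0.
  by apply/eqP; rewrite eq_le t0 andbT; nra.
rewrite mulf_eq0 => H; apply/cone_ptP; case/orP: H => [|].
  rewrite mulf_eq0 => /orP[] /eqP H; right; split => //.
    by rewrite -[LHS]/(s%:num) -rs.
  by rewrite -[LHS]/(r%:num) rs.
rewrite subr_eq0 -cos0 => /eqP /cos_inj a0.
left; split; last exact/val_inj.
have min0 : 0 = a.
  apply: a0; rewrite in_itv/= ?lexx ?pi_ge0//.
  by rewrite /a le_min pi_ge0 mdist_ge0/= ge_min lexx.
apply: mdist_positivity; move: min0; rewrite /a minEle; case: ifP => // _ p0.
by have := pi_gt0 R; rewrite -p0 ltxx.
Qed.

Lemma cone_plane_triangle (p1 p2 q1 q2 : R) :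
  Num.sqrt ((p1 + q1) ^+ 2 + (p2 + q2) ^+ 2) <=
  Num.sqrt (p1 ^+ 2 + p2 ^+ 2) + Num.sqrt (q1 ^+ 2 + q2 ^+ 2).
Proof.
set A := p1 ^+ 2 + p2 ^+ 2; set B := q1 ^+ 2 + q2 ^+ 2.
have A0 : 0 <= A by rewrite addr_ge0 ?sqr_ge0.
have B0 : 0 <= B by rewrite addr_ge0 ?sqr_ge0.
have CS : p1 * q1 + p2 * q2 <= Num.sqrt A * Num.sqrt B.
  rewrite -sqrtrM// (le_trans (ler_norm _))// -sqrtr_sqr ler_wsqrtr//.
  have := sqr_ge0 (p1 * q2 - p2 * q1); rewrite /A /B; nra.
rewrite -[leRHS]ger0_norm ?addr_ge0 ?sqrtr_ge0// -sqrtr_sqr ler_wsqrtr//.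
rewrite [leRHS]sqrrD !sqr_sqrtr// /A /B mulr2n; nra.
Qed.

Lemma cone_dist_triangle (w z v : cone) :
  cone_dist z v <= cone_dist z w + cone_dist w v.
Proof.
have [x0 [r0 ->]] := cone_pt_surj z; have [x1 [r1 ->]] := cone_pt_surj w.
have [x2 [r2 ->]] := cone_pt_surj v.
rewrite !cone_distE; set c := Num.min _ (mdist x0 x2).
set a := Num.min _ (mdist x0 x1); set b := Num.min _ (mdist x1 x2).
have pi0 := pi_ge0 R.
have r01 : 0 <= r1%:num * r2%:num by rewrite mulr_ge0.
have r02 : 0 <= r0%:num * r2%:num by rewrite mulr_ge0.
have d0 (x y : X) : 0 <= Num.min pi (mdist x y) by rewrite le_min pi0 mdist_ge0.
have dp (x y : X) : Num.min pi (mdist x y) <= pi by rewrite ge_min lexx.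
have cab : c <= a + b.
  have := metric_triangle x0 x1 x2; have := d0 x0 x1; have := d0 x1 x2.
  rewrite /a /b /c !minEle; do 3 case: ifP => ?; lra.
pose b' := Num.min b (pi - a).
have ap : a <= pi := dp _ _.
have a0 : 0 <= a := d0 _ _.
have bp : b <= pi := dp _ _.
have b0 : 0 <= b := d0 _ _.
have c0 : 0 <= c := d0 _ _.
have cp : c <= pi := dp _ _.
have b'0 : 0 <= b' by rewrite /b' le_min b0 subr_ge0.
have b'b : b' <= b by rewrite /b' ge_min lexx.
have ab'p : a + b' <= pi by rewrite addrC -lerBrDr /b' ge_min lexx orbT.
have cab' : c <= a + b' by rewrite /b' minEle; case: ifP => _; lra.
have cos_le (u t : R) : 0 <= u -> u <= t -> t <= pi -> cos t <= cos u.
  move=> u0; rewrite le_eqVlt => /orP[/eqP->//|ut tp]; apply: ltW.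
  by rewrite ltr_cos// in_itv/=; apply/andP; split; lra.
have Hb : cos b <= cos b' by apply: cos_le.
have Hc : cos (a + b') <= cos c by apply: cos_le.
have sq t : sin t ^+ 2 = 1 - cos t ^+ 2 :> R by rewrite sin2cos2.
apply: (@le_trans _ _ (Num.sqrt (((r0%:num * cos a - r1%:num) +
    (r1%:num - r2%:num * cos b')) ^+ 2 +
    (r0%:num * sin a + r2%:num * sin b') ^+ 2))).
  apply: ler_wsqrtr.
  rewrite cosD in Hc; have := ler_wpM2l r02 Hc; have := sq a; have := sq b'.
  move=> sb sa Hm.
  have -> : (r0%:num * cos a - r1%:num + (r1%:num - r2%:num * cos b')) ^+ 2 +
      (r0%:num * sin a + r2%:num * sin b') ^+ 2 =
      r0%:num ^+ 2 * (cos a ^+ 2 + sin a ^+ 2) +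
      r2%:num ^+ 2 * (cos b' ^+ 2 + sin b' ^+ 2) -
      2 * (r0%:num * r2%:num * (cos a * cos b' - sin a * sin b')) by ring.
  by rewrite sa sb; lra.
apply: (le_trans (cone_plane_triangle _ _ _ _)); apply: lerD; apply: ler_wsqrtr.
  rewrite [(r0%:num * sin a) ^+ 2]exprMn sq; lra.
rewrite [(r2%:num * sin b') ^+ 2]exprMn sq; have := ler_wpM2l r01 Hb; lra.
Qed.

HB.instance Definition _ := @isMetric.Build R cone cone_dist
  cone_distxx cone_dist_positivity cone_dist_sym cone_dist_triangle.

Lemma mdist_cone_sqr x0 x1 r0 r1 :
  mdist (cone_pt x0 r0) (cone_pt x1 r1) ^+ 2 =
  r0%:num ^+ 2 + r1%:num ^+ 2
  - 2 * r0%:num * r1%:num * cos (Num.min pi (mdist x0 x1)).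
Proof.
by rewrite [mdist _ _]cone_distE sqr_sqrtr// cone_pre_distE_ge0.
Qed.

End cone.

(* Main.v *)
(** The cosine of an upper angle is the liminf of the comparison cosines.
    Away from the apex, a cone geodesic from (x0, r0) develops to a straight
    segment in the plane, with velocity (c, k) in polar directions, and its base
    component is a reparametrized geodesic of X. By the spherical law of cosines,
    for two such geodesics of speeds L1, L2 the cone comparison cosine times L1 L2
    is c1 c2 + k1 k2 times the comparison cosine in X, up to an error tending to
    0. Summing, the quadratic form of the cone is a square plus the quadratic form
    of X with weights b k / L, some of which may vanish; conversely, lifting the
    geodesics of X with c = 0 transfers the condition down to X.

    The geodesics from the apex are the rays, and two rays make the angle
    min(pi, d(x1, x2)). Three angles a, b, c <= pi obeying the triangle
    inequality make the form nonnegative if a + b + c <= 2 pi, because then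
    cos c >= cos (a + b) and the form dominates |b1 + b2 e^(ia) + b3 e^(-ib)|^2;
    if a + b + c > 2 pi the weights at which this square vanishes violate LAC. *)

Require Import Defs.
From HB Require Import structures.
From mathcomp Require Import all_boot all_order all_algebra.
From mathcomp Require Import all_classical all_reals all_analysis.
From mathcomp Require Import ring lra.
Import Order.TTheory GRing.Theory Num.Theory.
Import numFieldNormedType.Exports.
Set Implicit Arguments.
Unset Strict Implicit.
Unset Printing Implicit Defensive.
Local Open Scope classical_set_scope.
Local Open Scope ring_scope.

(** * Trigonometric estimates *)

Section trigonometry.
Context {R : realType}.
Implicit Types a b c e u v w x : R.

Lemma ler_cos a b : 0 <= a -> a <= b -> b <= pi -> cos b <= cos a.
Proof.
move=> a0; rewrite le_eqVlt => /orP[/eqP->//|ab] bp; apply: ltW.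
by rewrite ltr_cos// in_itv/=; apply/andP; split; lra.
Qed.

Lemma ler_sin a b : - (pi / 2) <= a -> a <= b -> b <= pi / 2 -> sin a <= sin b.
Proof.
move=> a0; rewrite le_eqVlt => /orP[/eqP->//|ab] bp; apply: ltW.
by rewrite ltr_sin// in_itv/=; apply/andP; split; lra.
Qed.

Lemma sinB_eq0 a b : 0 <= a < pi / 2 -> 0 <= b < pi / 2 -> sin (a - b) = 0 -> a = b.
Proof.
move=> /andP[a0 ap] /andP[b0 bp]; rewrite -(@sin0 R) => /sin_inj.
rewrite !in_itv/= => E; have p0 := pi_gt0 R.
have /eqP : a - b = 0 by apply: E; apply/andP; split; lra.
by rewrite subr_eq0 => /eqP.
Qed.

Lemma cos2piB a : cos (2 * pi - a) = cos a.
Proof. by rewrite -[LHS]cosN opprB mulr_natl -(cosD2pi (a - _)) subrK. Qed.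

Lemma sin_mean_value x : 0 <= x -> exists2 c, 0 <= c <= x & sin x = cos c * x.
Proof.
move=> x0; have ds y : y \in `]0, x[ -> is_derive y 1 (@sin R) (cos y) by move=> _; exact: is_derive_sin.
have cs : {within `[0, x], continuous (@sin R)}.
  by apply: continuous_subspaceT => y; exact: continuous_sin.
have [c] := MVT_segment x0 ds cs.
by rewrite in_itv/= sin0 !subr0 => ? ?; exists c.
Qed.

Lemma sin_ge0_le x : 0 <= x -> sin x <= x.
Proof.
move=> x0; have [c _ ->] := sin_mean_value x0.
by rewrite -{2}(mul1r x) ler_wpM2r// cos_le1.
Qed.

Lemma sin_le_norm x : `|sin x| <= `|x|.
Proof.
wlog x0 : x / 0 <= x => [H|].
  have [/H//|/ltW x0] := leP 0 x.
  by rewrite -[`|x|]normrN -[`|sin x|]normrN -sinN H// oppr_ge0.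
rewrite (ger0_norm x0); have [xp|px] := leP x pi.
  by rewrite ger0_norm ?sin_ge0_le// sin_ge0_pi// x0.
have p2 := pi_ge2 R; have := sin_max x; lra.
Qed.

(** By the mean value theorem [sin x = cos c * x] with [c] between 0 and [x], and [cos] is
    continuous at 0 with value 1. *)
Lemma subr_sin_small e : 0 < e ->
  exists2 h, 0 < h & forall x, `|x| < h -> `|x - sin x| <= e * `|x|.
Proof.
move=> e0; have /cvgrPdist_lt/(_ e e0) := @continuous_cos R 0.
rewrite near_simpl => /nbhs_ballP[h /= h0 H]; exists h => //.
suff S x : 0 <= x -> x < h -> x - sin x <= e * x.
  move=> x xh; have [x0|/ltW x0] := leP 0 x.
    rewrite ger0_norm ?subr_ge0 ?sin_ge0_le// [in leRHS]ger0_norm//.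
    by rewrite S//; apply: le_lt_trans xh; exact: ler_norm.
  have nx0 : 0 <= - x by lra.
  have := sin_ge0_le nx0; rewrite sinN => sx.
  rewrite ler0_norm; last lra.
  have := S _ nx0; rewrite sinN ler0_norm// => /(_ _).
  rewrite ler0_norm// in xh; move/(_ xh); lra.
move=> x0 xh; have [c /andP[c0 cx] ->] := sin_mean_value x0.
have /H : ball (0 : R) h c by rewrite /ball/= sub0r normrN ger0_norm//; lra.
by rewrite cos0 => /(le_lt_trans (ler_norm _)) ce; nra.
Qed.

(* cos x = 1 - 2 sin^2(x / 2) turns every difference of cosines below into
   products of sines, so that sin x ~ x is the only asymptotic input. *)
Lemma cos_half x : cos x = 1 - 2 * sin (x / 2) ^+ 2.
Proof.
have {1}-> : x = (x / 2) *+ 2 by rewrite mulr2n; lra.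
by rewrite cos_mulr2n cos2sin2 !mulr2n; lra.
Qed.

Lemma cosB_half u v : cos v - cos u = 2 * (sin ((u + v) / 2) * sin ((u - v) / 2)).
Proof.
have -> : cos v = cos ((u + v) / 2 - (u - v) / 2) by congr cos; lra.
have -> : cos u = cos ((u + v) / 2 + (u - v) / 2) by congr cos; lra.
rewrite cosB cosD; lra.
Qed.

Lemma mul_subr_sin_small e h a b : 0 <= e ->
  (forall x, `|x| < h -> `|x - sin x| <= e * `|x|) -> `|a| < h -> `|b| < h ->
  `|a * b - sin a * sin b| <= 2 * e * (`|a| * `|b|).
Proof.
move=> e0 H /H ah /H bh.
have -> : a * b - sin a * sin b = a * (b - sin b) + sin b * (a - sin a) by ring.
apply: le_trans (ler_normD _ _) _; rewrite !normrM.
have sb := sin_le_norm b; have a0 := normr_ge0 a; have b0 := normr_ge0 b.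
have H1 := ler_wpM2l a0 bh.
have := ler_pM (normr_ge0 _) (normr_ge0 _) sb ah; lra.
Qed.

(* Infinitesimally, the spherical law of cosines is the Euclidean one. *)
Lemma spherical_cosine_law_small e : 0 < e ->
  exists2 h, 0 < h & forall u v w, 0 <= u < h -> 0 <= v < h ->
    `|u - v| <= w -> w <= u + v ->
    `|cos w - cos u * cos v - (u ^+ 2 + v ^+ 2 - w ^+ 2) / 2| <= e * (u * v).
Proof.
move=> e0; have e8 : 0 < e / 8 by lra.
have [h h0 H] := subr_sin_small e8.
(* [h / 2] keeps [(w + v) / 2] below [h]; the bounds [e] and [1] give [u * v <= e], which absorbs
   the quartic term. *)
exists (Num.min (h / 2) (Num.min e 1)); first by rewrite !lt_min; apply/and3P; split; lra.
move=> u v w; rewrite !lt_min => /and4P[u0 uh ue u1] /and4P[v0 vh ve v1].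
wlog uv : u v u0 v0 uh vh u1 v1 ue ve / u <= v => [W d1 d2|].
  have [uv|/ltW vu] := leP u v; first exact: W.
  have := W v u v0 u0 vh uh v1 u1 ve ue vu; rewrite distrC => /(_ d1).
  by rewrite [v + u]addrC [cos v * _]mulrC [v ^+ 2 + _]addrC [v * u]mulrC => /(_ d2).
rewrite ler_norml => /andP[w1 w2] w3.
(* Here [v ^+ 2 - w ^+ 2 = - 4 * a * b], and [cos v - cos w] is twice the product of the sines of
   [a] and [b]. Since [u <= v], the triangle inequalities give [|b| <= u / 2] and [a <= 3 / 2 * v],
   so errors relative to [a * |b|] are relative to [u * v]. *)
set a := (w + v) / 2; set b := (w - v) / 2.
have na : `|a| = a by rewrite ger0_norm// /a; lra.
have nb : `|b| <= u / 2 by rewrite /b ler_norml; apply/andP; split; lra.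
have ah : `|a| < h by rewrite na /a; lra.
have bh : `|b| < h by lra.
have nu : `|u / 2| = u / 2 by rewrite ger0_norm; lra.
have nv : `|v / 2| = v / 2 by rewrite ger0_norm; lra.
have u2h : `|u / 2| < h by rewrite nu; lra.
have e80 := ltW e8.
have := mul_subr_sin_small e80 H ah bh.
have := mul_subr_sin_small e80 H u2h u2h.
have E : cos w - cos u * cos v - (u ^+ 2 + v ^+ 2 - w ^+ 2) / 2 =
  2 * (a * b - sin a * sin b) - 2 * (u / 2 * (u / 2) - sin (u / 2) * sin (u / 2))
  - 4 * (sin (u / 2) ^+ 2 * sin (v / 2) ^+ 2).
  have := cosB_half w v; rewrite -/a -/b => E.
  have -> : cos w = cos v - 2 * (sin a * sin b) by lra.
  by rewrite (cos_half u) (cos_half v) /a /b; field.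
rewrite E nu na => P1 P2.
have su : sin (u / 2) ^+ 2 <= (u / 2) ^+ 2.
  by rewrite -[leLHS]real_normK ?num_real// ler_pXn2r ?nnegrE// ?sin_le_norm//; last lra;
  rewrite -{2}nu sin_le_norm.
have sv : sin (v / 2) ^+ 2 <= (v / 2) ^+ 2.
  by rewrite -[leLHS]real_normK ?num_real// ler_pXn2r ?nnegrE// ?sin_le_norm//; last lra;
  rewrite -{2}nv sin_le_norm.
have P3 := ler_pM (sqr_ge0 _) (sqr_ge0 _) su sv.
have P30 : 0 <= sin (u / 2) ^+ 2 * sin (v / 2) ^+ 2 by rewrite mulr_ge0 ?sqr_ge0.
have uu : u * u <= u * v by rewrite ler_wpM2l.
have uv0 : 0 <= u * v by rewrite mulr_ge0.
have ab : a * `|b| <= 3 / 4 * (u * v).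
  have av : a <= 3 / 2 * v by rewrite /a; lra.
  have a0 : 0 <= a by rewrite -na.
  have := ler_pM a0 (normr_ge0 b) av nb; lra.
have P4 : u / 2 * (u / 2) * (v / 2 * (v / 2)) <= e / 16 * (u * v).
  have uve : u * v <= e * 1 by apply: ler_pM => //; lra.
  have := ler_wpM2r uv0 uve; lra.
have Q1 : e / 8 * (a * `|b|) <= e / 8 * (3 / 4 * (u * v)) by rewrite ler_wpM2l.
have Q2 : e / 8 * (u * u) <= e / 8 * (u * v) by rewrite ler_wpM2l.
have euv : 0 <= e * (u * v) by rewrite mulr_ge0// ltW.
move: P1 P2; rewrite !ler_norml => /andP[P1a P1b] /andP[P2a P2b].
by rewrite !expr2 in P3 P30 *; apply/andP; split; lra.
Qed.

(** Here [k] is the Euclidean comparison cosine of the triangle. Replacing [u * v] by the product of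
    the sines costs another error of order [u * v], and [sin u >= 3 / 4 * u] makes the total error
    relative to that product. *)
Lemma spherical_cosine_law_approx e : 0 < e ->
  exists2 h, 0 < h & forall u v w k, 0 <= u < h -> 0 <= v < h ->
    `|u - v| <= w -> w <= u + v -> `|k| <= 1 ->
    k * (u * v) = (u ^+ 2 + v ^+ 2 - w ^+ 2) / 2 ->
    `|cos w - cos u * cos v - k * (sin u * sin v)| <= e * (sin u * sin v).
Proof.
move=> e0; have e8 : 0 < e / 8 by lra.
have [h h0 H] := spherical_cosine_law_small e8.
have [h' h'0 S] := subr_sin_small e8.
have [h2 h20 S2] := @subr_sin_small (1 / 4) ltac:(lra).
exists (Num.min h (Num.min h' h2)); first by rewrite !lt_min h0 h'0.
move=> u v w k; rewrite !lt_min => /and4P[u0 u1 u2 u3] /and4P[v0 v1 v2 v3] w1 w2 k1 kE.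
have := H u v w; rewrite u0 v0 => /(_ u1 v1 w1 w2) P1.
have e80 := ltW e8.
have nu := ger0_norm u0; have nv := ger0_norm v0.
have := @mul_subr_sin_small _ _ u v e80 S; rewrite nu nv => /(_ u2 v2) P2.
have := S2 u; have := S2 v; rewrite nu nv => /(_ v3) + /(_ u3).
rewrite !ler_norml => /andP[_ sv] /andP[_ su].
have P3 : 9 / 16 * (u * v) <= sin u * sin v.
  have u4 : 0 <= 3 / 4 * u by lra.
  have v4 : 0 <= 3 / 4 * v by lra.
  have := @ler_pM _ _ (sin u) _ (sin v) u4 v4; lra.
have P4 : `|k * (u * v - sin u * sin v)| <= 2 * (e / 8) * (u * v).
  by rewrite normrM -[leRHS]mul1r ler_pM.
have uv0 : 0 <= u * v by rewrite mulr_ge0.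
have Q : 9 / 16 * (e * (u * v)) <= e * (sin u * sin v).
  by have := ler_wpM2l (ltW e0) P3; lra.
have euv : 0 <= e * (u * v) by rewrite mulr_ge0// ltW.
rewrite -kE in P1; move: P1 P4; rewrite !ler_norml => /andP[? ?] /andP[? ?].
apply/andP; split; lra.
Qed.

End trigonometry.

(** * Comparison cosines and upper angles *)

Section comparison_cosine.
Context {R : realType} (Y : metricType R).
Implicit Types (p q : Y) (y : R -> Y).

Definition comparison_cos p q1 q2 : R :=
  (mdist p q1 ^+ 2 + mdist p q2 ^+ 2 - mdist q1 q2 ^+ 2) /
  (2 * mdist p q1 * mdist p q2).

(** If [p] is [q1] or [q2], the two remaining distances coincide and both sides vanish, so no
    nondegeneracy is assumed. *)
Lemma comparison_cosM p q1 q2 :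
  comparison_cos p q1 q2 * (mdist p q1 * mdist p q2) =
  (mdist p q1 ^+ 2 + mdist p q2 ^+ 2 - mdist q1 q2 ^+ 2) / 2.
Proof.
rewrite /comparison_cos; have [/mdist_positivity pq|n1] := eqVneq (mdist p q1) 0.
  by rewrite pq mdistxx expr0n/= add0r subrr !mul0r.
have [/mdist_positivity pq|n2] := eqVneq (mdist p q2) 0.
  by rewrite -pq mdistxx (metric_sym q1 p) expr0n/= addr0 subrr !mul0r.
by field; rewrite n1 n2.
Qed.

(** These are the squared triangle inequalities; for a zero denominator the quotient is 0 by
    convention. *)
Lemma comparison_cos_itv p q1 q2 : -1 <= comparison_cos p q1 q2 <= 1.
Proof.
have d1 := mdist_ge0 p q1; have d2 := mdist_ge0 p q2; have d3 := mdist_ge0 q1 q2.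
have t1 := metric_triangle q1 p q2; have t2 := metric_triangle p q2 q1.
have t3 := metric_triangle p q1 q2.
rewrite (metric_sym q1 p) in t1; rewrite (metric_sym q2 q1) in t2.
have := comparison_cosM p q1 q2; set k := comparison_cos _ _ _ => kE.
have [E|n] := eqVneq (mdist p q1 * mdist p q2) 0.
  suff -> : k = 0 by rewrite oppr_le0 ler01.
  by rewrite /k /comparison_cos -mulrA E mulr0 invr0 mulr0.
have m0 : 0 < mdist p q1 * mdist p q2 by rewrite lt_neqAle eq_sym n mulr_ge0.
apply/andP; split; rewrite -(ler_pM2r m0) kE ?mul1r ?mulN1r; nra.
Qed.

Lemma mdist_geodesic p y (t : R) : nontrivial_geodesic_from p y -> 0 <= t <= 1 ->
  mdist p (y t) = t * mdist (y 0) (y 1).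
Proof.
case=> gy <- _ t01; have /andP[t0 t1] := t01.
by rewrite gy ?lexx ?ler01// sub0r normrN ger0_norm.
Qed.

Lemma nontrivial_geodesic_length p y : nontrivial_geodesic_from p y ->
  0 < mdist (y 0) (y 1).
Proof. by case=> _ _ /eqP; rewrite mdist_gt0. Qed.

Lemma cos_continuous (a e : R) : 0 < e ->
  exists2 h, 0 < h & forall b, `|b - a| < h -> `|cos b - cos a| < e.
Proof.
move=> e0; have /cvgrPdist_lt/(_ e e0) := @continuous_cos R a.
rewrite near_simpl => /nbhs_ballP[h /= h0 H]; exists h => // b ba.
by rewrite distrC; apply: H; rewrite /ball/= distrC.
Qed.

Lemma filter_prod_right0P (P : R * R -> Prop) :
  filter_prod (0 : R)^'+ (0 : R)^'+ P <->
  exists2 d : R, 0 < d &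
    forall s t, 0 < s < d -> 0 < t < d -> P (s, t).
Proof.
split.
  case=> [[A B] /= [/nbhs_ballP[d1 /= d10 A1] /nbhs_ballP[d2 /= d20 B1]] AB].
  exists (Num.min d1 d2); first by rewrite lt_min d10 d20.
  move=> s t /andP[s0 +] /andP[t0 +]; rewrite !lt_min.
  move=> /andP[s1 _] /andP[_ t2]; apply: AB; split.
    by apply: A1 => //=; rewrite /ball/= sub0r normrN gtr0_norm.
  by apply: B1 => //=; rewrite /ball/= sub0r normrN gtr0_norm.
case=> d d0 H; exists ([set s : R | 0 < s < d], [set s : R | 0 < s < d]) => /=.
  by split; near=> s; apply/andP; split; near: s;
    [exact: nbhs_right_gt|exact: nbhs_right_lt|exact: nbhs_right_gt|exact: nbhs_right_lt].
by move=> [s t]/= [s1 t1]; apply: H.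
Unshelve. all: by end_near. Qed.

(** Comparison angles lie in [[0, pi]], hence so does their limsup, and [fine] can be removed from
    [upper_angle]. *)
Lemma upper_angle_itv y1 y2 : exists A : R, 0 <= A <= pi /\
  (limf_esup
    (fun st : R * R => (comparison_angle (y1 0) (y1 st.1) (y2 st.2))%:E)
    (filter_prod (0 : R)^'+ (0 : R)^'+)) = A%:E.
Proof.
have ang s t : 0 <= comparison_angle (y1 0) (y1 s) (y2 t) <= pi.
  by rewrite acos_ge0 ?acos_lepi// comparison_cos_itv.
set f := fun st : R * R => _; set F := filter_prod _ _; set A := limf_esup _ _.
have A0 : (0%:E <= A)%E.
  apply: le_ereal_inf_tmp => /= x [V FV <-{x}].
  (* The supremum over [V] is bounded below by the value at one point of [V], namely
     [(d / 2, d / 2)]. *)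
  have /filter_prod_right0P[d d0 H] := FV.
  have d2 : 0 < d / 2 < d by apply/andP; split; lra.
  apply: (@le_trans _ _ (f (d / 2, d / 2))).
    by rewrite /f lee_fin; case/andP: (ang (d / 2) (d / 2)).
  by apply: ereal_sup_ubound; exists (d / 2, d / 2) => //; exact: H.
have Ap : (A <= pi%:E)%E.
  apply: ge_ereal_inf; exists (ereal_sup (f @` setT)); first by exists setT => //; exact: filterT.
  apply: ge_ereal_sup => x [[s t] _ <-].
  by rewrite /f lee_fin; case/andP: (ang s t).
exists (fine A); have Af : A \is a fin_num.
  by rewrite fin_numE; apply/andP; split; apply/eqP => E; move: A0 Ap; rewrite E.
by rewrite fineK// -!lee_fin fineK// A0 Ap.
Qed.

(* As cos is decreasing on [0, pi], the cosine of the upper angle is the liminf of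
   the comparison cosines; the next two lemmas are the two halves of this fact. *)
Lemma cos_upper_angle_lower y1 y2 (e : R) : 0 < e ->
  exists2 d : R, 0 < d & forall s t, 0 < s < d -> 0 < t < d ->
    cos (upper_angle y1 y2) - e <= comparison_cos (y1 0) (y1 s) (y2 t).
Proof.
move=> e0; have [A [/andP[A0 Ap] AE]] := upper_angle_itv y1 y2.
rewrite /upper_angle AE/=; have [h h0 H] := cos_continuous A e0.
have : (ereal_inf [set ereal_sup ((fun st : R * R =>
    (comparison_angle (y1 0) (y1 st.1) (y2 st.2))%:E) @` V) |
    V in filter_prod (0 : R)^'+ (0 : R)^'+] < (A + h)%:E)%E.
  by rewrite -limf_esupE AE lte_fin ltrDl.
move=> /ereal_inf_lt[_ [V /filter_prod_right0P[d d0 Vd] <-]] lt.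
exists d => // s t sd td.
have ci := comparison_cos_itv (y1 0) (y1 s) (y2 t).
set c := comparison_cos _ _ _ in ci *.
have ac : acos c < A + h.
  rewrite -lte_fin; apply: le_lt_trans lt; apply: ereal_sup_ubound.
  by exists (s, t) => //; exact: Vd.
have cE : cos (acos c) = c by rewrite acosK// in_itv/=.
(* Up to [A] monotonicity of [cos] suffices; beyond it the angle is within [h] of [A] and continuity
   applies. *)
have [aA|Aa] := leP (acos c) A.
  have : cos A <= cos (acos c) by rewrite ler_cos ?acos_ge0.
  rewrite cE; lra.
have /H : `|acos c - A| < h by rewrite gtr0_norm; lra.
rewrite cE ltr_norml => /andP[]; lra.
Qed.

Lemma cos_upper_angle_upper y1 y2 (e d : R) : 0 < e -> 0 < d ->
  exists s t, [/\ 0 < s < d, 0 < t < d &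
    comparison_cos (y1 0) (y1 s) (y2 t) <= cos (upper_angle y1 y2) + e].
Proof.
move=> e0 d0; have [A [/andP[A0 Ap] AE]] := upper_angle_itv y1 y2.
rewrite /upper_angle AE/=; have [h h0 H] := cos_continuous A e0.
pose V := [set st : R * R | 0 < st.1 < d /\ 0 < st.2 < d].
have FV : filter_prod (0 : R)^'+ (0 : R)^'+ V by apply/filter_prod_right0P; exists d.
have : ((A - h)%:E < ereal_sup ((fun st : R * R =>
    (comparison_angle (y1 0) (y1 st.1) (y2 st.2))%:E) @` V))%E.
  apply: (@lt_le_trans _ _ A%:E); first by rewrite lte_fin ltrBlDr ltrDl.
  by rewrite -AE; apply: ereal_inf_lbound; exists V.
move=> /ereal_sup_gt[_ [[s t] /= [sd td] <-]]; rewrite lte_fin => lt.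
exists s, t; split=> //.
have ci := comparison_cos_itv (y1 0) (y1 s) (y2 t).
rewrite /comparison_angle -/(comparison_cos _ _ _) in lt.
set c := comparison_cos _ _ _ in ci lt *.
have cE : cos (acos c) = c by rewrite acosK// in_itv/=.
have [aA|Aa] := leP A (acos c).
  have : cos (acos c) <= cos A by rewrite ler_cos ?acos_lepi.
  rewrite cE; lra.
have /H : `|acos c - A| < h by rewrite ltr0_norm; lra.
rewrite cE ltr_norml => /andP[]; lra.
Qed.

End comparison_cosine.

(** * Angles between cone geodesics away from the apex *)

Section cone_directions.
Context {R : realType} (X : metricType R).
Implicit Types (x : X) (r : {nonneg R}).

Lemma mdist_cone_sqr_lt_pi x0 x1 r0 r1 : mdist x0 x1 <= pi ->
  mdist (cone_pt x0 r0) (cone_pt x1 r1) ^+ 2 =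
  r0%:num ^+ 2 + r1%:num ^+ 2 - 2 * r0%:num * r1%:num * cos (mdist x0 x1).
Proof. by move=> d; rewrite mdist_cone_sqr (min_idPr d). Qed.

(** The hypotheses give the point [i] the Cartesian coordinates [(r0 + ci * si, ki * si)]. After
    multiplication by [s1 * s2] the left side is [r1 * r2] times the error in the spherical law.
    That error is relative to [sin u * sin v], so the scale [s1 * s2] cancels. *)
Lemma cone_comparison_cos (e : R) : 0 < e ->
  exists2 h : R, 0 < h &
  forall x0 x1 x2 r0 r1 r2 (s1 s2 c1 c2 k1 k2 L1 L2 : R),
    mdist x0 x1 < h -> mdist x0 x2 < h -> 0 < s1 -> 0 < s2 ->
    r1%:num * cos (mdist x0 x1) = r0%:num + c1 * s1 ->
    r1%:num * sin (mdist x0 x1) = k1 * s1 ->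
    r2%:num * cos (mdist x0 x2) = r0%:num + c2 * s2 ->
    r2%:num * sin (mdist x0 x2) = k2 * s2 ->
    mdist (cone_pt x0 r0) (cone_pt x1 r1) = s1 * L1 ->
    mdist (cone_pt x0 r0) (cone_pt x2 r2) = s2 * L2 ->
  `|L1 * L2 * comparison_cos (cone_pt x0 r0) (cone_pt x1 r1) (cone_pt x2 r2)
    - (c1 * c2 + k1 * k2 * comparison_cos x0 x1 x2)| <= e * (k1 * k2).
Proof.
move=> e0; have [h h0 H] := spherical_cosine_law_approx e0.
have p0 := pi_gt0 R.
(* With two sides below [pi / 2] the third is at most [pi], so the cone distance is not
   truncated. *)
exists (Num.min h (pi / 2)); first by rewrite lt_min h0/=; lra.
move=> x0 x1 x2 r0 r1 r2 s1 s2 c1 c2 k1 k2 L1 L2.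
rewrite !lt_min => /andP[u1 u2] /andP[v1 v2] s10 s20 C1 K1 C2 K2 D1 D2.
have uu := mdist_ge0 x0 x1; have vv := mdist_ge0 x0 x2.
have w1 := metric_triangle x1 x0 x2; rewrite (metric_sym x1 x0) in w1.
have w2 := metric_triangle x0 x1 x2; have w3 := metric_triangle x0 x2 x1.
rewrite (metric_sym x2 x1) in w3.
have up : mdist x0 x1 <= pi by lra.
have vp : mdist x0 x2 <= pi by lra.
have wp : mdist x1 x2 <= pi by lra.
have ww : `|mdist x0 x1 - mdist x0 x2| <= mdist x1 x2.
  by rewrite ler_norml; apply/andP; split; lra.
have ck : `|comparison_cos x0 x1 x2| <= 1 by rewrite ler_norml comparison_cos_itv.
have := H _ _ _ _ _ _ ww w1 ck (comparison_cosM x0 x1 x2).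
rewrite uu vv => /(_ u1 v1).
have := comparison_cosM (cone_pt x0 r0) (cone_pt x1 r1) (cone_pt x2 r2).
rewrite !mdist_cone_sqr_lt_pi// D1 D2.
set g := comparison_cos _ _ _; set k := comparison_cos _ _ _.
move: C1 K1 C2 K2; set u := mdist x0 x1; set v := mdist x0 x2; set w := mdist x1 x2.
move=> C1 K1 C2 K2 G.
set z := cos w - _ - _ => Hz.
have r12 : 0 <= r1%:num * r2%:num by rewrite mulr_ge0.
have s12 : 0 < s1 * s2 by rewrite mulr_gt0.
rewrite -(ler_pM2l s12) -{1}(gtr0_norm s12) -normrM.
have -> : s1 * s2 * (L1 * L2 * g - (c1 * c2 + k1 * k2 * k)) = r1%:num * r2%:num * z.
  have -> : s1 * s2 * (L1 * L2 * g - (c1 * c2 + k1 * k2 * k)) =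
    g * (s1 * L1 * (s2 * L2)) - (c1 * s1 * (c2 * s2) + k1 * s1 * (k2 * s2) * k) by ring.
  have -> : c1 * s1 = r1%:num * cos u - r0%:num by lra.
  have -> : c2 * s2 = r2%:num * cos v - r0%:num by lra.
  by rewrite G -K1 -K2 /z; field.
rewrite normrM ger0_norm//.
have -> : s1 * s2 * (e * (k1 * k2)) = e * (k1 * s1 * (k2 * s2)) by ring.
rewrite -K1 -K2; have := ler_wpM2l r12 Hz; lra.
Qed.

(* In the flat sector spanned by x0 and x s, with z0 = (r0, 0) as base point, the
   point z s has Cartesian coordinates (r0 + c s, k s): z leaves z0 with radial
   velocity c and angular velocity k / r0. *)
Definition has_direction x0 r0 (z : R -> cone X) (x : R -> X) (c k : R) : Prop :=
  exists2 h : R, 0 < h & forall s, 0 < s < h -> exists r : {nonneg R},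
    [/\ z s = cone_pt (x s) r, mdist x0 (x s) < pi / 2,
        r%:num * cos (mdist x0 (x s)) = r0%:num + c * s
      & r%:num * sin (mdist x0 (x s)) = k * s].

(** If the angle were at least [a = min e (pi / 4)], then [k * s] would be at least [r * sin a],
    where [r >= r0 - |c| * s]; this fails for small [s]. *)
Lemma has_direction_cvg x0 r0 z (x : R -> X) (c k e : R) : 0 < r0%:num -> 0 <= k ->
  has_direction x0 r0 z x c k -> 0 < e ->
  exists2 d : R, 0 < d & forall s, 0 < s < d -> mdist x0 (x s) < e.
Proof.
move=> r00 k0 [h h0 H] e0; have p0 := pi_gt0 R.
set a := Num.min e (pi / 4).
have a0 : 0 < a by rewrite lt_min e0/=; lra.
have ap : a <= pi / 4 by rewrite /a ge_min lexx orbT.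
have ae : a <= e by rewrite /a ge_min lexx.
have sa : 0 < sin a by apply: sin_gt0_pihalf; apply/andP; split; lra.
have ca : 0 < cos a by apply: cos_gt0_pihalf; apply/andP; split; lra.
have kc0 : 0 < 2 * (k + `|c| + 1) by have := normr_ge0 c; lra.
exists (Num.min h (r0%:num * sin a / (2 * (k + `|c| + 1)))).
  by rewrite lt_min h0/= divr_gt0// mulr_gt0.
move=> s /andP[s0]; rewrite lt_min ltr_pdivlMr// => /andP[sh sr].
have [|r [_ xp C K]] := H s; first by rewrite s0.
rewrite ltNge; apply/negP => ex.
set u := mdist _ _ in ex xp C K.
have su : sin a <= sin u by apply: ler_sin; lra.
have sal := sin_le1 a; have cul := cos_le1 u.
have rr : r%:num * sin a <= r%:num * sin u by rewrite ler_wpM2l.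
have cs : - (`|c| * s) <= c * s.
  rewrite -mulNr ler_pM2r//; have := ler_norm (- c); rewrite normrN; lra.
have rge : r0%:num - `|c| * s <= r%:num.
  have : r%:num * cos u <= r%:num * 1 by rewrite ler_wpM2l.
  lra.
have nc := normr_ge0 c.
have : (r0%:num - `|c| * s) * sin a <= k * s.
  by rewrite -K; apply: le_trans rr; rewrite ler_wpM2r// ltW.
have : `|c| * s * sin a <= `|c| * s * 1 by rewrite ler_wpM2l// mulr_ge0// ltW.
have : 0 <= `|c| * s by rewrite mulr_ge0// ltW.
have : 0 <= k * s by rewrite mulr_ge0// ltW.
lra.
Qed.

Section pair.
Variables (x0 : X) (r0 : {nonneg R}).
Hypothesis r00 : 0 < r0%:num.
Variables (z1 z2 : R -> cone X) (x1 x2 : R -> X) (c1 c2 k1 k2 : R).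
Hypothesis gz1 : nontrivial_geodesic_from (cone_pt x0 r0) z1.
Hypothesis gz2 : nontrivial_geodesic_from (cone_pt x0 r0) z2.
Hypotheses (k10 : 0 <= k1) (k20 : 0 <= k2).
Hypothesis dz1 : has_direction x0 r0 z1 x1 c1 k1.
Hypothesis dz2 : has_direction x0 r0 z2 x2 c2 k2.
Let L1 := mdist (z1 0) (z1 1).
Let L2 := mdist (z2 0) (z2 1).

Lemma has_direction_comparison_cos (e : R) : 0 < e ->
  exists2 d : R, 0 < d & forall s t, 0 < s < d -> 0 < t < d ->
  `|L1 * L2 * comparison_cos (cone_pt x0 r0) (z1 s) (z2 t)
    - (c1 * c2 + k1 * k2 * comparison_cos x0 (x1 s) (x2 t))| <= e * (k1 * k2).
Proof.
move=> e0; have [h h0 H] := cone_comparison_cos e0.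
have [d1 d10 D1] := has_direction_cvg r00 k10 dz1 h0.
have [d2 d20 D2] := has_direction_cvg r00 k20 dz2 h0.
have [h1 h10 H1] := dz1; have [h2 h20 H2] := dz2.
exists (Num.min (Num.min d1 d2) (Num.min 1 (Num.min h1 h2))).
  by rewrite !lt_min d10 d20 h10 h20 ltr01.
move=> s t; rewrite !lt_min => /andP[s0 /andP[/andP[sd1 sd2] /and3P[s1 sh1 sh2]]].
move=> /andP[t0 /andP[/andP[td1 td2] /and3P[t1 th1 th2]]].
have [|r1 [E1 _ C1 K1]] := H1 s; first by rewrite s0.
have [|r2 [E2 _ C2 K2]] := H2 t; first by rewrite t0.
have M1 : mdist (cone_pt x0 r0) (z1 s) = s * L1.
  by apply: (mdist_geodesic gz1); rewrite !ltW.
have M2 : mdist (cone_pt x0 r0) (z2 t) = t * L2.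
  by apply: (mdist_geodesic gz2); rewrite !ltW.
rewrite E1 E2; rewrite E1 in M1; rewrite E2 in M2.
apply: (H _ _ _ _ _ _ _ _ _ _ _ _ _ _ _ _ s0 t0 C1 K1 C2 K2 M1 M2).
  by rewrite D1// s0.
by rewrite D2// t0.
Qed.

(** The comparison cosine of the cone is evaluated at times where it nearly attains its liminf. The
    factor [k1 * k2] stays in the hypothesis so that it is void as soon as one geodesic is
    radial. *)
Lemma cone_angle_ge (K : R) :
  (forall e : R, 0 < e -> exists2 d : R, 0 < d & forall s t, 0 < s < d -> 0 < t < d ->
    k1 * k2 * (K - e) <= k1 * k2 * comparison_cos x0 (x1 s) (x2 t)) ->
  c1 * c2 + k1 * k2 * K <= L1 * L2 * cos (upper_angle z1 z2).
Proof.
move=> H; apply/ler_addgt0Pr => e e0.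
have L10 : 0 < L1 := nontrivial_geodesic_length gz1.
have L20 : 0 < L2 := nontrivial_geodesic_length gz2.
have L0 : 0 < L1 * L2 by rewrite mulr_gt0.
have kk0 : 0 <= k1 * k2 by rewrite mulr_ge0.
(* [M] collects three errors: [L1 * L2] from the upper angle, and [k1 * k2] once from the cone
   estimate and once from the hypothesis. *)
set M := L1 * L2 + 2 * (k1 * k2).
have M0 : 0 < M by rewrite /M; lra.
set e' := e / M.
have e'0 : 0 < e' by rewrite divr_gt0.
have [d1 d10 H1] := H _ e'0.
have [d2 d20 H2] := has_direction_comparison_cos e'0.
have d0 : 0 < Num.min d1 d2 by rewrite lt_min d10.
have [s [t []]] := cos_upper_angle_upper z1 z2 e'0 d0.
rewrite !lt_min => /and3P[s0 s1 s2] /and3P[t0 t1 t2].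
have -> : z1 0 = cone_pt x0 r0 by case: gz1.
move/(ler_wpM2l (ltW L0)).
have := H1 s t; rewrite s0 t0 => /(_ s1 t1).
have := H2 s t; rewrite s0 t0 => /(_ s2 t2).
rewrite ler_norml => /andP[P1 _] P2 P3.
have : e' * M = e by rewrite /e' divfK// gt_eqF.
rewrite /M; lra.
Qed.

End pair.
End cone_directions.

(** * Planar development of cone geodesics starting away from the apex *)

Section cone_geodesics.
Context {R : realType} (X : metricType R).
Implicit Types (x : X) (r : {nonneg R}).

Lemma cone_mdist_ge0 x0 x1 r0 r1 :
  `|r0%:num - r1%:num| <= mdist (cone_pt x0 r0) (cone_pt x1 r1).
Proof.
rewrite -ler_sqr ?nnegrE ?mdist_ge0// real_normK ?num_real// mdist_cone_sqr.
have : 0 <= r0%:num * r1%:num by rewrite mulr_ge0.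
have := cos_le1 (Num.min pi (mdist x0 x1)); nra.
Qed.

(** At an angle of at least [pi / 2] the cosine is nonpositive, and the squared distance is at least
    [r0 ^+ 2]. *)
Lemma cone_mdist_lt_pihalf x0 x1 r0 r1 :
  mdist (cone_pt x0 r0) (cone_pt x1 r1) < r0%:num -> mdist x0 x1 < pi / 2.
Proof.
move=> lt; rewrite ltNge; apply/negP => d; have p0 := pi_gt0 R.
have : r0%:num ^+ 2 <= mdist (cone_pt x0 r0) (cone_pt x1 r1) ^+ 2.
  rewrite mdist_cone_sqr; set a := Num.min _ _.
  have : cos a <= cos (pi / 2).
    apply: ler_cos; last by rewrite ge_min lexx.
      by lra.
    by rewrite le_min d andbT; lra.
  rewrite cos_pihalf => ca.
  have : 0 <= r0%:num * r1%:num by rewrite mulr_ge0.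
  have := sqr_ge0 r1%:num; nra.
by rewrite ler_sqr ?nnegrE ?mdist_ge0// leNgt lt.
Qed.

(* Equality in the triangle inequality: developing the two triangles side by
   side in the plane, the three points must be collinear there. *)
Lemma cone_collinear x0 x1 x2 r0 r1 r2 (l D : R) :
  0 < r0%:num -> 0 < r2%:num -> 0 < l < 1 ->
  mdist x0 x1 + mdist x1 x2 <= pi ->
  mdist (cone_pt x0 r0) (cone_pt x1 r1) = l * D ->
  mdist (cone_pt x1 r1) (cone_pt x2 r2) = (1 - l) * D ->
  mdist (cone_pt x0 r0) (cone_pt x2 r2) = D ->
  [/\ mdist x0 x2 = mdist x0 x1 + mdist x1 x2,
      r1%:num * cos (mdist x0 x1) = (1 - l) * r0%:num + l * (r2%:num * cos (mdist x0 x2))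
    & r1%:num * sin (mdist x0 x1) = l * (r2%:num * sin (mdist x0 x2))].
Proof.
move=> r00 r20 /andP[l0 l1] abp E01 E12 E02.
have a0 := mdist_ge0 x0 x1; have b0 := mdist_ge0 x1 x2; have c0 := mdist_ge0 x0 x2.
have cab := metric_triangle x0 x1 x2.
have := mdist_cone_sqr_lt_pi r0 r1 (_ : mdist x0 x1 <= pi).
have := mdist_cone_sqr_lt_pi r1 r2 (_ : mdist x1 x2 <= pi).
have := mdist_cone_sqr_lt_pi r0 r2 (_ : mdist x0 x2 <= pi).
rewrite E01 E12 E02.
move: a0 b0 c0 cab abp {E01 E12 E02}.
set a := mdist x0 x1; set b := mdist x1 x2; set c := mdist x0 x2.
move=> a0 b0 c0 cab abp /(_ ltac:(lra)) E02 /(_ ltac:(lra)) E12 /(_ ltac:(lra)) E01.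
set p := a + b in cab abp.
have cb : cos b = cos p * cos a + sin p * sin a by rewrite -cosB; congr cos; rewrite /p; lra.
have cp : cos p <= cos c by exact: ler_cos.
(* With the third point developed at angle [p = a + b], [A] and [B] are the coordinates of the
   deviation of the middle point from the segment, and [C] measures how far [c] falls short of
   [p]. *)
set A := r1%:num * cos a - (1 - l) * r0%:num - l * (r2%:num * cos p).
set B := r1%:num * sin a - l * (r2%:num * sin p).
set C := l * (1 - l) * (r0%:num * r2%:num) * (cos c - cos p).
have lr0 : 0 < l * (1 - l) * (r0%:num * r2%:num) by rewrite !mulr_gt0// subr_gt0.
have C0 : 0 <= C by rewrite mulr_ge0 ?subr_ge0// ltW.
have ABC : A ^+ 2 + B ^+ 2 + 2 * C = 0.
  have -> : A ^+ 2 + B ^+ 2 + 2 * C = r1%:num ^+ 2 * (cos a ^+ 2 + sin a ^+ 2)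
    + (1 - l) ^+ 2 * r0%:num ^+ 2
    + l ^+ 2 * r2%:num ^+ 2 * (cos p ^+ 2 + sin p ^+ 2)
    - 2 * (1 - l) * (r0%:num * r1%:num * cos a)
    - 2 * l * (r1%:num * r2%:num * (cos p * cos a + sin p * sin a))
    + 2 * l * (1 - l) * (r0%:num * r2%:num * cos c) by rewrite /A /B /C; ring.
  rewrite !cos2Dsin2 -cb.
  (* This is Stewart's relation for the three given distances; it vanishes identically. *)
  transitivity ((1 - l) * ((l * D) ^+ 2) + l * (((1 - l) * D) ^+ 2) - l * (1 - l) * D ^+ 2).
    by rewrite E01 E12 E02; ring.
  ring.
have A0 := sqr_ge0 A; have B0 := sqr_ge0 B.
have /eqP : A ^+ 2 = 0 by lra.
rewrite sqrf_eq0 => /eqP A1.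
have /eqP : B ^+ 2 = 0 by lra.
rewrite sqrf_eq0 => /eqP B1.
have /eqP : C = 0 by lra.
rewrite mulf_eq0 gt_eqF//= subr_eq0 => /eqP/cos_inj.
have p0 : 0 <= p by exact: addr_ge0.
rewrite !in_itv/= c0 p0 abp (le_trans cab abp) => /(_ isT isT) cE.
by split=> //; rewrite -?/a -?/c cE; [move: A1|move: B1]; rewrite /A /B; lra.
Qed.

(** On a short interval [[0, h]] collinearity makes the planar coordinates of [z] affine in time,
    which yields [c] and [k]. It also makes base distances equal to differences of angles. So if the
    total angle [al] is positive, the base component parametrized by angle is a geodesic; if
    [al = 0] the motion is radial. *)
Lemma cone_geodesic_direction x0 r0 (z : R -> cone X) : 0 < r0%:num ->
  nontrivial_geodesic_from (cone_pt x0 r0) z ->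
  exists (x : R -> X) (c k : R), [/\ 0 <= k, has_direction x0 r0 z x c k &
    k = 0 \/ exists y : R -> X, nontrivial_geodesic_from x0 y /\
      exists2 h : R, 0 < h & forall s, 0 < s < h ->
        0 < mdist x0 (x s) /\ x s = y (mdist x0 (x s) / mdist (y 0) (y 1))].
Proof.
move=> r00 ntz; have [gz z0 _] := ntz; have p0 := pi_gt0 R.
have L0 := nontrivial_geodesic_length ntz; set L := mdist (z 0) (z 1) in L0.
pose x s := (repr (z s)).1; pose r s := (repr (z s)).2.
have zE s : z s = cone_pt (x s) (r s).
  by rewrite /cone_pt -surjective_pairing reprK.
have [xx0 rr0] : x 0 = x0 /\ r 0 = r0.
  by have := z0; rewrite zE => /cone_ptP[//|[_ E]]; rewrite E ltxx in r00.
(* Up to time [h] the curve moves by at most [r0 / 8], so its radii stay at least [7 / 8 * r0], and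
   any two of its points are at base distance below [pi / 2]. *)
set h := Num.min 1 (r0%:num / (8 * L)).
have h0 : 0 < h by rewrite lt_min ltr01 divr_gt0//; lra.
have h1 : h <= 1 by rewrite ge_min lexx.
have hL : h * L <= r0%:num / 8.
  have : h <= r0%:num / (8 * L) by rewrite ge_min lexx orbT.
  by rewrite ler_pdivlMr ?mulr_gt0//; lra.
have dz s t : 0 <= s -> s <= t -> t <= h -> mdist (z s) (z t) = (t - s) * L.
  move=> s0 st th; rewrite gz; [|apply/andP; split; lra..].
  by rewrite distrC -/L ger0_norm ?subr_ge0.
have rge s : 0 <= s -> s <= h -> 7 / 8 * r0%:num <= (r s)%:num.
  move=> s0 sh; have := dz _ _ (lexx 0) s0 sh; rewrite !zE subr0 xx0 rr0 => D.
  have := cone_mdist_ge0 x0 (x s) r0 (r s); rewrite D ler_norml => /andP[_].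
  have : s * L <= h * L by rewrite ler_pM2r.
  lra.
have rgt s : 0 <= s -> s <= h -> 0 < (r s)%:num.
  by move=> s0 sh; have := rge s s0 sh; lra.
have dlt s t : 0 <= s -> s <= t -> t <= h -> mdist (x s) (x t) < pi / 2.
  move=> s0 st th; apply: (@cone_mdist_lt_pihalf _ _ (r s) (r t)).
  rewrite -!zE dz//; have := rge s s0 (le_trans st th).
  have : (t - s) * L <= h * L by rewrite ler_pM2r//; lra.
  lra.
pose th s := mdist x0 (x s).
have th0 : th 0 = 0 by rewrite /th xx0 mdistxx.
have thge s : 0 <= th s by exact: mdist_ge0.
have thlt s : 0 <= s -> s <= h -> th s < pi / 2 by move=> s0 sh; rewrite /th -xx0 dlt.
have col s t : 0 < s -> s < t -> t <= h ->
    [/\ th t = th s + mdist (x s) (x t),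
      (r s)%:num * cos (th s) = (1 - s / t) * r0%:num + s / t * ((r t)%:num * cos (th t))
    & (r s)%:num * sin (th s) = s / t * ((r t)%:num * sin (th t))].
  move=> s0 st tt; have t0 : 0 < t := lt_trans s0 st.
  apply: (@cone_collinear _ _ _ r0 (r s) (r t) (s / t) (t * L)) => //.
  - by apply: rgt => //; exact: ltW.
  - by rewrite divr_gt0//= ltr_pdivrMr// mul1r.
  - have := thlt s (ltW s0) (le_trans (ltW st) tt).
    have := dlt s t (ltW s0) (ltW st) tt; rewrite /th; lra.
  - rewrite -xx0 -rr0 -!zE (dz 0 s) ?subr0 ?(ltW s0)//; last lra.
    by rewrite mulrA divfK// gt_eqF.
  - by rewrite -!zE (dz s t) ?(ltW s0) ?(ltW st)//; field; rewrite gt_eqF.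
  - by rewrite -xx0 -rr0 -!zE (dz 0 t) ?subr0// ltW.
have dth s t : 0 <= s -> s <= t -> t <= h -> th t = th s + mdist (x s) (x t).
  rewrite le_eqVlt => /orP[/eqP<-|s0].
    by move=> _ _; rewrite th0 add0r xx0.
  rewrite le_eqVlt => /orP[/eqP<-|st] tt; first by rewrite mdistxx addr0.
  by have [] := col s t s0 st tt.
have dthE s t : 0 <= s <= h -> 0 <= t <= h -> mdist (x s) (x t) = `|th s - th t|.
  wlog st : s t / s <= t => [W H1 H2|].
    have [st|/ltW ts] := leP s t; first exact: W.
    by rewrite metric_sym distrC W.
  move=> /andP[s0 _] /andP[_ tt]; have := dth s t s0 st tt; have := mdist_ge0 (x s) (x t).
  by move=> d0 E; rewrite distrC ger0_norm; lra.
set al := th h; set rh := (r h)%:num.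
have rh0 : 0 < rh by apply: rgt => //; exact: ltW.
have al0 : 0 <= al by exact: thge.
have alp : al < pi / 2 by apply: thlt => //; exact: ltW.
have chart s : 0 <= s -> s <= h ->
    (r s)%:num * cos (th s) = (1 - s / h) * r0%:num + s / h * (rh * cos al) /\
    (r s)%:num * sin (th s) = s / h * (rh * sin al).
  rewrite le_eqVlt => /orP[/eqP<-|s0].
    by move=> _; rewrite th0 rr0 cos0 sin0 !mul0r subr0 addr0 mulr1 mul1r mulr0.
  rewrite le_eqVlt => /orP[/eqP->|st].
    by rewrite divff ?gt_eqF// subrr mul0r add0r !mul1r.
  by have [] := col s h s0 st (lexx h).
have sal0 : 0 <= sin al by apply: sin_ge0_pi; apply/andP; split; lra.
exists x, ((rh * cos al - r0%:num) / h), (rh * sin al / h); split.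
- by rewrite divr_ge0 ?mulr_ge0// ltW.
- exists h => // s /andP[s0 sh]; exists (r s).
  have [C S] := chart s (ltW s0) (ltW sh); split; [exact: zE| | |].
  + by apply: thlt; apply: ltW.
  + by rewrite -/(th s) C; field; rewrite gt_eqF.
  + by rewrite -/(th s) S; field; rewrite gt_eqF.
have [al00|aln] := eqVneq al 0; first by left; rewrite al00 sin0 mulr0 mul0r.
right; have al1 : 0 < al by rewrite lt_neqAle eq_sym aln.
have sal1 : 0 < sin al by apply: sin_gt0_pihalf; rewrite al1.
(* sg t is the parameter at which the segment meets the ray of angle t *)
pose den t := r0%:num * sin t + rh * sin (al - t).
pose sg t := h * (r0%:num * sin t / den t).
have s1 t : 0 <= t <= al -> 0 <= r0%:num * sin t.
  by move=> /andP[t0 ta]; rewrite mulr_ge0 ?(ltW rh0)// sin_ge0_pi//; apply/andP; split; lra.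
have s2 t : 0 <= t <= al -> 0 <= rh * sin (al - t).
  by move=> /andP[t0 ta]; rewrite mulr_ge0 ?(ltW rh0)// sin_ge0_pi//; apply/andP; split; lra.
have den0 t : 0 <= t <= al -> 0 < den t.
  move=> tal; have /andP[] := tal; rewrite le_eqVlt => /orP[/eqP<-|t0] ta.
    by rewrite /den sin0 mulr0 add0r subr0 mulr_gt0.
  have := s2 t tal; rewrite /den => s2t; apply: ltr_wpDr => //.
  by rewrite mulr_gt0// sin_gt0_pihalf//; apply/andP; split; lra.
have sgh t : 0 <= t <= al -> 0 <= sg t <= h.
  move=> tal; have := s2 t tal; have := s1 t tal; have := den0 t tal => d0 u0 v0.
  rewrite mulr_ge0 ?divr_ge0 ?(ltW h0) ?(ltW d0)//=.
  by rewrite -[leRHS]mulr1 ler_pM2l// ler_pdivrMr// mul1r /den; lra.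
have thsg t : 0 <= t <= al -> th (sg t) = t.
  move=> tal; have /andP[g0 gh] := sgh t tal; have d0 := den0 t tal.
  have [C S] := chart _ g0 gh.
  have rg0 := rgt _ g0 gh; have tg := thlt _ g0 gh; have tg0 := thge (sg t).
  have /andP[t0 ta] := tal.
  (* Both angles lie in [[0, pi / 2)], so it is enough that the cross product of the point at time
     [sg t] with the direction of angle [t] vanishes. *)
  apply/esym/sinB_eq0; rewrite ?t0 ?tg0 ?(le_lt_trans ta)//.
  apply: (mulfI (lt0r_neq0 rg0)); rewrite mulr0 sinB.
  have -> : (r (sg t))%:num * (sin t * cos (th (sg t)) - cos t * sin (th (sg t))) =
    sin t * ((r (sg t))%:num * cos (th (sg t))) - cos t * ((r (sg t))%:num * sin (th (sg t))).
    by ring.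
  have sgE : sg t / h = r0%:num * sin t / den t by rewrite /sg mulrAC divff ?mul1r// gt_eqF.
  rewrite C S sgE.
  have dn : den t != 0 by rewrite gt_eqF.
  have dE : den t = r0%:num * sin t + rh * (sin al * cos t - cos al * sin t) by rewrite /den sinB.
  transitivity (r0%:num * sin t / den t *
      (den t - (r0%:num * sin t + rh * (sin al * cos t - cos al * sin t)))).
    by field.
  by rewrite -dE subrr mulr0.
pose y t := x (sg (t * al)).
have dy s t : 0 <= s <= 1 -> 0 <= t <= 1 -> mdist (y s) (y t) = `|s - t| * al.
  have scale u : 0 <= u <= 1 -> 0 <= u * al <= al.
    move=> /andP[u0 u1]; rewrite mulr_ge0//= -[leRHS]mul1r ler_wpM2r//.
  move=> /scale s01 /scale t01.
  rewrite dthE ?sgh// !thsg// -mulrBl normrM [`|al|]ger0_norm//.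
have i0 : (0 : R) <= (0 : R) <= 1 by rewrite lexx ler01.
have i1 : (0 : R) <= (1 : R) <= 1 by rewrite lexx ler01.
have dy01 : mdist (y 0) (y 1) = al by rewrite dy// sub0r normrN normr1 mul1r.
exists y; split.
  split.
  - by move=> s t s01 t01; rewrite dy01 dy.
  - by rewrite /y mul0r /sg sin0 mulr0 mul0r mulr0.
  - by apply/eqP; rewrite -mdist_gt0 dy01.
exists h => // s /andP[s0 sh]; rewrite dy01 /y divfK ?gt_eqF//.
have [_ S] := chart s (ltW s0) (ltW sh).
have ths0 : 0 < th s.
  rewrite lt_neqAle thge andbT eq_sym; apply/eqP => E; move: S; rewrite E sin0 mulr0.
  by move/esym/eqP; rewrite gt_eqF// !(mulr_gt0, invr_gt0).
(* Both points have angle [th s], and by [dthE] the angle determines the point. *)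
split=> //; apply: mdist_positivity.
have tal : 0 <= th s <= al.
  by rewrite thge/= /al (dth s h (ltW s0) (ltW sh) (lexx h)) lerDl mdist_ge0.
by rewrite -/(th s) dthE ?sgh// ?thsg// ?subrr ?normr0// (ltW s0) (ltW sh).
Qed.

End cone_geodesics.

(** * Transfer of the angle condition between the base and the cone *)

Section local_angle_condition.
Context {R : realType}.

Lemma sum_mulr_sqr (m : nat) (a : 'I_m -> R) :
  \sum_(i < m) \sum_(j < m) a i * a j = (\sum_(i < m) a i) ^+ 2.
Proof. by rewrite expr2 big_distrlr. Qed.

(** The weights [b i + e] are positive, and the form is a polynomial in [e] with constant term [S];
    a negative [S] would be visible at small [e]. Zero weights arise from radial cone geodesics. *)
Lemma LAC_weight_ge0 (Y : metricType R) m (p : Y) (y : 'I_m -> R -> Y) (b : 'I_m -> R) :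
  LAC m p -> (forall i, nontrivial_geodesic_from p (y i)) -> (forall i, 0 <= b i) ->
  0 <= \sum_(i < m) \sum_(j < m) b i * b j * cos (upper_angle (y i) (y j)).
Proof.
move=> lac yg b0; pose C i j := cos (upper_angle (y i) (y j)).
set S := \sum_(i < m) _; rewrite leNgt; apply/negP => S0.
pose T := \sum_(i < m) \sum_(j < m) (b i + b j) * C i j.
pose U := \sum_(i < m) \sum_(j < m) C i j.
have H e : 0 < e -> 0 <= S + e * T + e ^+ 2 * U.
  move=> e0; have := lac y (fun i => b i + e) yg (fun i => ltr_wpDl (b0 i) e0).
  rewrite (_ : (\sum_(i < m) _)%R = S + e * T + e ^+ 2 * U)//.
  rewrite /S /T /U !mulr_sumr -!big_split/=; apply: eq_bigr => i _.
  rewrite !mulr_sumr -!big_split/=; apply: eq_bigr => j _.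
  by rewrite /C; ring.
have TU0 : 0 < 2 * (`|T| + `|U| + 1) by have := normr_ge0 T; have := normr_ge0 U; lra.
pose e := Num.min 1 (- S / (2 * (`|T| + `|U| + 1))).
have e0 : 0 < e by rewrite lt_min ltr01 divr_gt0// oppr_gt0.
have e1 : e <= 1 by rewrite ge_min lexx.
have eS : e * (2 * (`|T| + `|U| + 1)) <= - S.
  by rewrite -ler_pdivlMr// ge_min lexx orbT.
have := H e e0.
have : e * T <= e * `|T| by rewrite ler_pM2l// ler_norm.
have : e ^+ 2 * U <= e * `|U|.
  have : e ^+ 2 * U <= e ^+ 2 * `|U| by rewrite ler_pM2l ?exprn_gt0// ler_norm.
  have : e ^+ 2 * `|U| <= e * `|U| by rewrite ler_wpM2r// expr2 ger_pMr.
  lra.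
lra.
Qed.

Variable X : metricType R.

Lemma LAC_cone m (x0 : X) (r0 : {nonneg R}) : 0 < r0%:num -> LAC m x0 ->
  LAC m (cone_pt x0 r0).
Proof.
move=> r00 lac z b zg b0.
have [x /choice[c /choice[k ck]]] := choice (fun i => cone_geodesic_direction r00 (zg i)).
pose L i := mdist (z i 0) (z i 1).
have L0 i : 0 < L i := nontrivial_geodesic_length (zg i).
have k0 i : 0 <= k i by have [] := ck i.
have dir i : has_direction x0 r0 (z i) (x i) (c i) (k i) by have [] := ck i.
pose a i := b i / L i * c i; pose be i := b i / L i * k i.
have be0 i : 0 <= be i by rewrite mulr_ge0// divr_ge0// ltW.
(* With weights [b i / L i] the radial parts [c i * c j] add up to a square, which leaves the form
   of [M] with weights [be]. *)
suff [M [M0 HM]] : exists M : 'I_m -> 'I_m -> R,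
    0 <= \sum_(i < m) \sum_(j < m) be i * be j * M i j /\
    forall i j, c i * c j + k i * k j * M i j <= L i * L j * cos (upper_angle (z i) (z j)).
  apply: (@le_trans _ _ (\sum_(i < m) \sum_(j < m) (a i * a j + be i * be j * M i j))).
    under eq_bigr do rewrite big_split/=.
    by rewrite big_split/= sum_mulr_sqr addr_ge0// sqr_ge0.
  apply: ler_sum => i _; apply: ler_sum => j _.
  have bL : 0 <= b i / L i * (b j / L j).
    by rewrite mulr_ge0// divr_ge0 ?ltW.
  have := ler_wpM2l bL (HM i j).
  have -> : b i / L i * (b j / L j) * (L i * L j * cos (upper_angle (z i) (z j))) =
    b i * b j * cos (upper_angle (z i) (z j)).
    by field; rewrite !gt_eqF.
  by apply: le_trans; rewrite /a /be le_eqVlt; apply/orP; left; apply/eqP; ring.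
have [i0 ki0|kall] := pickP (fun i => k i != 0); last first.
  have kE i : k i = 0 by apply/eqP; have := kall i => /negbFE.
  exists (fun _ _ => 0); split.
    by rewrite big1// => i _; rewrite big1// => j _; rewrite mulr0.
  move=> i j; apply: (cone_angle_ge r00 (zg i) (zg j) (k0 i) (k0 j) (dir i) (dir j)).
  by move=> e e0; exists 1 => // s t _ _; rewrite kE !mul0r.
(* [LAC] in the base needs a geodesic for every index; [y0] fills in at radial ones, whose weight
   [be] is 0. *)
have [y0 y0g] : exists y, nontrivial_geodesic_from x0 y.
  by have [_ _ [E|[y [yg _]]]] := ck i0; [rewrite E eqxx in ki0|exists y].
have /choice[y yP] i : exists y, nontrivial_geodesic_from x0 y /\
   (k i = 0 \/ exists2 h : R, 0 < h & forall s, 0 < s < h ->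
    0 < mdist x0 (x i s) /\ x i s = y (mdist x0 (x i s) / mdist (y 0) (y 1))).
  have [_ _ [E|[y [yg H]]]] := ck i; first by exists y0; split => //; left.
  by exists y; split => //; right.
have yg i : nontrivial_geodesic_from x0 (y i) by have [] := yP i.
(* Small times of [x i] correspond to small times of [y i], so the lower bound on comparison cosines
   carries over. *)
have param i (d : R) : k i != 0 -> 0 < d -> exists2 h : R, 0 < h & forall s, 0 < s < h ->
    exists2 s', 0 < s' < d & x i s = y i s'.
  move=> ki d0; have l0 := nontrivial_geodesic_length (yg i).
  have [_ [E|[h h0 H]]] := yP i; first by rewrite E eqxx in ki.
  have dl0 : 0 < d * mdist (y i 0) (y i 1) by rewrite mulr_gt0.
  have [h' h'0 H'] := has_direction_cvg r00 (k0 i) (dir i) dl0.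
  exists (Num.min h h'); first by rewrite lt_min h0.
  move=> s /andP[s0]; rewrite lt_min => /andP[sh sh'].
  have [|x0s xs] := H s; first by rewrite s0.
  exists (mdist x0 (x i s) / mdist (y i 0) (y i 1)) => //.
  by rewrite divr_gt0//= ltr_pdivrMr// H'// s0.
exists (fun i j => cos (upper_angle (y i) (y j))); split.
  exact: (LAC_weight_ge0 lac yg be0).
move=> i j; apply: (cone_angle_ge r00 (zg i) (zg j) (k0 i) (k0 j) (dir i) (dir j)).
move=> e e0.
have [E|ki] := eqVneq (k i) 0; first by exists 1 => // s t _ _; rewrite E !mul0r.
have [E|kj] := eqVneq (k j) 0; first by exists 1 => // s t _ _; rewrite E mulr0 !mul0r.
have [d d0 H] := cos_upper_angle_lower (y i) (y j) e0.
have [h h0 P] := param i d ki d0; have [h' h'0 P'] := param j d kj d0.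
exists (Num.min h h'); first by rewrite lt_min h0.
move=> s t; rewrite !lt_min => /and3P[s0 s1 s2] /and3P[t0 t1 t2].
have [|s' sd ->] := P s; first by rewrite s0.
have [|t' td ->] := P' t; first by rewrite t0.
rewrite ler_wpM2l ?mulr_ge0//.
have := H _ _ sd td; by have [_ -> _] := yg i.
Qed.

(** * Lifting geodesics of the base to the cone *)

Lemma sin_atan (u : R) : sin (atan u) = u * cos (atan u).
Proof.
have c0 : 0 < cos (atan u).
  by apply: cos_gt0_pihalf; rewrite atan_gtNpi2 atan_ltpi2.
by rewrite -{2}(atanK u) /tan divfK// gt_eqF.
Qed.

(* The lift starts orthogonally to the radial direction: in the plane it is the
   vertical segment from (r0, 0) to (r0, k). *)
Lemma lift_geodesic (x0 : X) (r0 : {nonneg R}) (y : R -> X) : 0 < r0%:num ->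
  nontrivial_geodesic_from x0 y ->
  exists (z : R -> cone X) (x : R -> X) (k : R),
    [/\ 0 < k, nontrivial_geodesic_from (cone_pt x0 r0) z, mdist (z 0) (z 1) = k,
      has_direction x0 r0 z x 0 k
    & forall d : R, 0 < d -> exists2 d' : R, 0 < d' & forall s', 0 < s' < d' ->
        exists2 s, 0 < s < d & x s = y s'].
Proof.
move=> r00 yg; have [gy y0 _] := yg; have l0 := nontrivial_geodesic_length yg.
have p0 := pi_gt0 R; set l := mdist (y 0) (y 1) in l0.
(* Only an initial piece of [y] of length [a] is lifted, so that the total angle stays below
   [pi / 2]. *)
set a := Num.min l (pi / 4).
have a0 : 0 < a by rewrite lt_min l0; lra.
have al : a <= l by rewrite ge_min lexx.
have ap : a <= pi / 4 by rewrite ge_min lexx orbT.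
have aK : atan (tan a) = a by rewrite tanK// in_itv/=; apply/andP; split; lra.
set K := tan a in aK.
have K0 : 0 < K by rewrite divr_gt0 ?sin_gt0_pihalf ?cos_gt0_pihalf//; apply/andP; split; lra.
(* The point [(r0, r0 * K * s)] of the vertical segment has angle [ph s] and radius [r0 * q s]. *)
clearbody K; pose ph s := atan (K * s).
have ph0 : ph 0 = 0 by rewrite /ph mulr0 atan0.
have phi01 s : 0 <= s <= 1 -> 0 <= ph s <= a.
  move=> /andP[s0 s1]; rewrite -[X in X <= _](@atan0 R) -aK /ph.
  by rewrite !le_atan ?ger_pMr// mulr_ge0// ltW.
pose x s := y (ph s / l).
have dxE s t : 0 <= s <= 1 -> 0 <= t <= 1 -> mdist (x s) (x t) = `|ph s - ph t|.
  have ph1 u : 0 <= u <= 1 -> 0 <= ph u / l <= 1.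
    move=> /phi01/andP[u0 u1]; rewrite divr_ge0 ?(ltW l0)//= ler_pdivrMr// mul1r.
    exact: le_trans al.
  move=> s01 t01; rewrite /x gy ?ph1// -mulrBl normrM normfV -/l [`|l|]gtr0_norm//.
  by rewrite divfK// gt_eqF.
pose q s : R := Num.sqrt (1 + (K * s) ^+ 2).
have q0 s : 0 < q s by rewrite sqrtr_gt0 ltr_pwDl// sqr_ge0.
have qc s : q s * cos (ph s) = 1 by rewrite cos_atan divff// gt_eqF.
have qs s : q s * sin (ph s) = K * s by rewrite sin_atan mulrCA qc mulr1.
have q2 s : q s ^+ 2 = 1 + (K * s) ^+ 2 by rewrite sqr_sqrtr// addr_ge0// sqr_ge0.
have rq0 s : 0 <= r0%:num * q s by rewrite mulr_ge0// ltW.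
pose r s := NngNum (rq0 s).
pose z s := cone_pt (x s) (r s).
have dz s t : 0 <= s <= 1 -> 0 <= t <= 1 -> mdist (z s) (z t) = `|s - t| * (r0%:num * K).
  move=> s01 t01.
  have : mdist (z s) (z t) ^+ 2 = (`|s - t| * (r0%:num * K)) ^+ 2.
    rewrite mdist_cone_sqr_lt_pi dxE//; last first.
      have /andP[? ?] := phi01 s s01; have /andP[? ?] := phi01 t t01.
      by rewrite ler_norml; apply/andP; split; lra.
    rewrite cos_norm cosB /=.
    transitivity (r0%:num ^+ 2 * (q s ^+ 2 + q t ^+ 2
      - 2 * ((q s * cos (ph s)) * (q t * cos (ph t)) + (q s * sin (ph s)) * (q t * sin (ph t))))).
      by ring.
    rewrite !qc !qs !q2 !exprMn real_normK ?num_real//; ring.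
  move/eqP; rewrite eqrXn2 ?mdist_ge0// => [/eqP//|].
  by rewrite !mulr_ge0// ltW.
have i0 : (0 : R) <= (0 : R) <= 1 by rewrite lexx ler01.
have i1 : (0 : R) <= (1 : R) <= 1 by rewrite lexx ler01.
have z01 : mdist (z 0) (z 1) = r0%:num * K by rewrite dz// sub0r normrN normr1 mul1r.
have k0 : 0 < r0%:num * K by rewrite mulr_gt0.
exists z, x, (r0%:num * K); split=> //.
- split.
  + by move=> s t s01 t01; rewrite z01 dz.
  + apply/cone_ptP; left; rewrite /x ph0 mul0r; split=> //; apply: val_inj => /=.
    by rewrite /q mulr0 expr0n/= addr0 sqrtr1 mulr1.
  + by apply/eqP; rewrite -mdist_gt0 z01.
- exists 1 => // s /andP[s0 s1]; exists (r s).
  have s01 : 0 <= s <= 1 by rewrite !ltW.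
  have /andP[? ?] := phi01 s s01.
  have xE : mdist x0 (x s) = ph s.
    have <- : x 0 = x0 by rewrite /x ph0 mul0r.
    by rewrite dxE// ph0 sub0r normrN ger0_norm.
  split=> //; rewrite xE; first by lra.
    by rewrite /= -mulrA qc mulr1 mul0r addr0.
  by rewrite /= -mulrA qs mulrA.
- move=> d d0; have at0 : 0 < atan (K * d) by rewrite -(@atan0 R) lt_atan// mulr_gt0.
  (* Solving [ph s = s' * l] gives [s = tan (s' * l) / K]; the first bound keeps [s' * l] below
     [pi / 2], the second keeps [s] below [d]. *)
  exists (Num.min a (atan (K * d)) / l); first by rewrite divr_gt0// lt_min a0.
  move=> s' /andP[s'0]; rewrite ltr_pdivlMr// lt_min => /andP[sa sd].
  have sl0 : 0 < s' * l by rewrite mulr_gt0.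
  have in_dom u : 0 <= u -> u < pi / 2 -> u \in `](- (pi / 2)), (pi / 2)[.
    by move=> ? ?; rewrite in_itv/=; apply/andP; split; lra.
  have sl1 : s' * l < pi / 2 by lra.
  exists (tan (s' * l) / K).
    rewrite divr_gt0//=; last first.
      by rewrite -(@tan0 R) ltr_tan// in_dom ?(ltW sl0)//; lra.
    rewrite ltr_pdivrMr// -[X in _ < X]mulrC -[X in _ < X]atanK.
    by rewrite ltr_tan// in_dom// ?(ltW sl0) ?(ltW at0)// atan_ltpi2.
  rewrite /x /ph [K * _]mulrC divfK ?gt_eqF// tanK ?in_dom ?(ltW sl0)//.
  by rewrite mulfK// gt_eqF.
Qed.

(** The lifts have [c = 0] and length [k], so comparison cosines of the cone and the base agree in
    the limit. Times where the base cosine is nearly minimal pull back to the lifts, so each cosine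
    entry in the cone is at most the one in the base. *)
Lemma LAC_base m (x0 : X) (r0 : {nonneg R}) : 0 < r0%:num -> LAC m (cone_pt x0 r0) ->
  LAC m x0.
Proof.
move=> r00 lac y b yg b0.
have [z /choice[x /choice[k zxk]]] := choice (fun i => lift_geodesic r00 (yg i)).
have zg i : nontrivial_geodesic_from (cone_pt x0 r0) (z i) by have [] := zxk i.
apply: (le_trans (lac z b zg b0)).
apply: ler_sum => i _; apply: ler_sum => j _; rewrite ler_pM2l ?mulr_gt0//.
have [ki _ zki di pi_] := zxk i; have [kj _ zkj dj pj] := zxk j.
apply/ler_addgt0Pr => e e0; have e3 : 0 < e / 3 by lra.
have [d d0 D] := cos_upper_angle_lower (z i) (z j) e3.
have [h h0 H] := has_direction_comparison_cos r00 (zg i) (zg j) (ltW ki) (ltW kj) di dj e3.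
have dh0 : 0 < Num.min d h by rewrite lt_min d0.
have [di' di'0 Pi] := pi_ _ dh0; have [dj' dj'0 Pj] := pj _ dh0.
have dd0 : 0 < Num.min di' dj' by rewrite lt_min di'0.
have [s' [t' []]] := cos_upper_angle_upper (y i) (y j) e3 dd0.
rewrite !lt_min => /and3P[s'0 s'i s'j] /and3P[t'0 t'i t'j].
have [|s /andP[s0]] := Pi s'; first by rewrite s'0.
rewrite lt_min => /andP[sd sh] <-.
have [|t /andP[t0]] := Pj t'; first by rewrite t'0.
rewrite lt_min => /andP[td th] <-.
have [_ -> _] := yg i => U.
have := D s t; rewrite s0 t0 sd td => /(_ isT isT).
have [_ -> _] := zg i => C.
have := H s t; rewrite s0 t0 sh th => /(_ isT isT).
rewrite zki zkj mulr0 add0r -mulrBr normrM gtr0_norm ?mulr_gt0//.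
rewrite mulrC ler_pM2r ?mulr_gt0// ler_norml => /andP[_]; lra.
Qed.

End local_angle_condition.

(** * The apex *)

Section apex.
Context {R : realType} (X : metricType R) (o : X).
Implicit Types (x y : X) (r s : {nonneg R}).

Definition truncated_dist x y : R := Num.min pi (mdist x y).

Lemma truncated_dist_itv x y : 0 <= truncated_dist x y <= pi.
Proof. by rewrite le_min pi_ge0 mdist_ge0 ge_min lexx. Qed.

Lemma truncated_distC x y : truncated_dist x y = truncated_dist y x.
Proof. by rewrite /truncated_dist metric_sym. Qed.

Lemma truncated_distxx x : truncated_dist x x = 0.
Proof. by rewrite /truncated_dist mdistxx; apply/min_idPr/pi_ge0. Qed.

Lemma truncated_dist_triangle x y z :
  truncated_dist x z <= truncated_dist x y + truncated_dist y z.
Proof.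
have := metric_triangle x y z; have := mdist_ge0 x y; have := mdist_ge0 y z.
have := pi_ge0 R; rewrite /truncated_dist !minEle; do 3 case: ifP => ?; lra.
Qed.

Lemma truncated_dist_eq0 x y : truncated_dist x y = 0 -> x = y.
Proof.
rewrite /truncated_dist minEle; case: ifP => _; last exact: mdist_positivity.
by move=> E; have := pi_gt0 R; rewrite E ltxx.
Qed.

Lemma mdist_apex x r : mdist (apex o) (cone_pt x r) = r%:num.
Proof.
apply/eqP; rewrite -(@eqrXn2 _ 2) ?mdist_ge0//; apply/eqP.
by rewrite mdist_cone_sqr/= mulr0 !mul0r expr0n/= add0r subr0.
Qed.

Lemma comparison_cos_apex x y r s : 0 < r%:num -> 0 < s%:num ->
  comparison_cos (apex o) (cone_pt x r) (cone_pt y s) = cos (truncated_dist x y).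
Proof.
move=> r0 s0; rewrite /comparison_cos !mdist_apex mdist_cone_sqr -/(truncated_dist x y).
by field; rewrite !gt_eqF.
Qed.

Definition is_ray x (z : R -> cone X) : Prop := exists2 L : R, 0 < L &
  forall s : R, 0 < s <= 1 -> exists2 r, r%:num = s * L & z s = cone_pt x r.

(** The points [z s] and [z 1] have radii [s * L] and [L] and distance [(1 - s) * L]; the law of
    cosines then forces the angle between them to be 0. *)
Lemma apex_geodesic_ray z : nontrivial_geodesic_from (apex o) z -> exists x, is_ray x z.
Proof.
move=> zg; have L0 := nontrivial_geodesic_length zg; have [gz _ _] := zg.
have [x [r zE]] := cone_pt_surj (z 1).
set L := mdist (z 0) (z 1) in L0; exists x, L => // s /andP[s0 s1].
have [y [t yE]] := cone_pt_surj (z s).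
have rL : r%:num = L.
  by rewrite -(mdist_apex x) -zE (mdist_geodesic zg) ?mul1r// lexx ler01.
have tL : t%:num = s * L.
  by rewrite -(mdist_apex y) -yE (mdist_geodesic zg)// s1 ltW.
have := gz s 1; rewrite (ltW s0) s1 lexx ler01 => /(_ isT isT)/(congr1 (fun u => u ^+ 2)).
rewrite yE zE mdist_cone_sqr -yE -zE -/L exprMn real_normK ?num_real// rL tL.
rewrite -/(truncated_dist y x) => E.
have sL0 : 0 < 2 * s * L ^+ 2 by rewrite !mulr_gt0// exprn_gt0.
have : 2 * s * L ^+ 2 * (cos (truncated_dist y x) - 1) = 0 by lra.
move/eqP; rewrite mulf_eq0 gt_eqF//= subr_eq0 -(@cos0 R) => /eqP/cos_inj.
rewrite !in_itv/= truncated_dist_itv lexx pi_ge0 => /(_ isT isT)/truncated_dist_eq0 yx.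
by exists t => //; rewrite yE yx.
Qed.

Lemma ray_geodesic x : exists2 z, nontrivial_geodesic_from (apex o) z & is_ray x z.
Proof.
(* The absolute value makes the radius nonnegative for every real [s]; on [[0, 1]] it is [s]. *)
pose z (s : R) := cone_pt x (NngNum (normr_ge0 s)).
have dz (s t : R) : 0 <= s -> 0 <= t -> mdist (z s) (z t) = `|s - t|.
  move=> s0 t0; apply/eqP; rewrite -(@eqrXn2 _ 2) ?mdist_ge0//; apply/eqP.
  rewrite mdist_cone_sqr -/(truncated_dist x x) truncated_distxx cos0/=.
  by rewrite (ger0_norm s0) (ger0_norm t0) real_normK ?num_real//; ring.
have dz01 : mdist (z 0) (z 1) = 1 by rewrite dz ?ler01// sub0r normrN normr1.
exists z; first split.
- by move=> s t /andP[s0 _] /andP[t0 _]; rewrite dz01 mulr1 dz.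
- by apply/cone_ptP; right; rewrite /= normr0.
- by apply/eqP; rewrite -mdist_gt0 dz01 ltr01.
exists 1 => // s /andP[s0 _]; exists (NngNum (normr_ge0 s)) => //=.
by rewrite mulr1 gtr0_norm.
Qed.

(** The comparison cosine is constant for times in [(0, 1]], hence equal to its liminf. *)
Lemma cos_upper_angle_ray x1 x2 z1 z2 :
  nontrivial_geodesic_from (apex o) z1 -> is_ray x1 z1 -> is_ray x2 z2 ->
  cos (upper_angle z1 z2) = cos (truncated_dist x1 x2).
Proof.
move=> [_ z0 _] [L1 L10 H1] [L2 L20 H2].
have cE (s t : R) : 0 < s <= 1 -> 0 < t <= 1 ->
    comparison_cos (z1 0) (z1 s) (z2 t) = cos (truncated_dist x1 x2).
  move=> s01 t01; have [r rE ->] := H1 s s01; have [r' rE' ->] := H2 t t01.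
  have /andP[s0 _] := s01; have /andP[t0 _] := t01.
  by rewrite z0 comparison_cos_apex// ?rE ?rE' mulr_gt0.
apply/eqP; rewrite eq_le; apply/andP; split; apply/ler_addgt0Pr => e e0.
  have [d d0 H] := cos_upper_angle_lower z1 z2 e0.
  set s := Num.min (d / 2) 1.
  have s0 : 0 < s by rewrite lt_min ltr01 andbT divr_gt0.
  have s1 : s <= 1 by rewrite ge_min lexx orbT.
  have sd : s < d by apply: (@le_lt_trans _ _ (d / 2)); [rewrite ge_min lexx|lra].
  have := H s s; rewrite s0 sd cE ?s0// => /(_ isT isT); lra.
have [s [t [/andP[s0 s1] /andP[t0 t1]]]] := cos_upper_angle_upper z1 z2 e0 (@ltr01 R).
by rewrite cE ?s0 ?t0 ?(ltW s1) ?(ltW t1).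
Qed.

Lemma LAC_apexP m : LAC m (apex o) <->
  forall (x : 'I_m -> X) (b : 'I_m -> R), (forall i, 0 < b i) ->
    0 <= \sum_(i < m) \sum_(j < m) b i * b j * cos (truncated_dist (x i) (x j)).
Proof.
split=> [lac x b b0|H z b zg b0].
  have /choice[z zP] i : exists z, nontrivial_geodesic_from (apex o) z /\ is_ray (x i) z.
    by have [z] := ray_geodesic (x i); exists z.
  have zg i : nontrivial_geodesic_from (apex o) (z i) by have [] := zP i.
  apply: le_trans (lac z b zg b0) _.
  apply: ler_sum => i _; apply: ler_sum => j _.
  by rewrite (@cos_upper_angle_ray (x i) (x j))//; [case: (zP i)|case: (zP j)].
have [x xP] := choice (fun i => apex_geodesic_ray (zg i)).
apply: le_trans (H x b b0) _; apply: ler_sum => i _; apply: ler_sum => j _.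
by rewrite (@cos_upper_angle_ray (x i) (x j)).
Qed.

Lemma LAC_apex_diameter m : (diameter X <= (pi / 2)%:E)%E -> LAC m (apex o).
Proof.
move=> D; apply/LAC_apexP => x b b0; apply: sumr_ge0 => i _; apply: sumr_ge0 => j _.
rewrite mulr_ge0//; first by rewrite mulr_ge0 ?ltW.
have p0 := pi_gt0 R.
have : mdist (x i) (x j) <= pi / 2.
  rewrite -lee_fin; apply: le_trans D; apply: ereal_sup_ubound.
  by exists (x i, x j).
have /andP[d0 _] := truncated_dist_itv (x i) (x j).
have : truncated_dist (x i) (x j) <= mdist (x i) (x j) by rewrite ge_min lexx orbT.
by move=> ? ?; apply: cos_ge0_pihalf; apply/andP; split; lra.
Qed.

Lemma LAC3_apexP : LAC 3 (apex o) <->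
  forall x1 x2 x3 (b1 b2 b3 : R), 0 < b1 -> 0 < b2 -> 0 < b3 ->
    0 <= b1 ^+ 2 + b2 ^+ 2 + b3 ^+ 2 + 2 * (b1 * b2 * cos (truncated_dist x1 x2)
      + b1 * b3 * cos (truncated_dist x1 x3) + b2 * b3 * cos (truncated_dist x2 x3)).
Proof.
have sum3 (x : 'I_3 -> X) (b : 'I_3 -> R) (i0 := ord0) (i1 := lift ord0 ord0)
    (i2 := lift ord0 (lift ord0 ord0)) :
  \sum_(i < 3) \sum_(j < 3) b i * b j * cos (truncated_dist (x i) (x j)) =
  b i0 ^+ 2 + b i1 ^+ 2 + b i2 ^+ 2 + 2 * (b i0 * b i1 * cos (truncated_dist (x i0) (x i1))
   + b i0 * b i2 * cos (truncated_dist (x i0) (x i2))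
   + b i1 * b i2 * cos (truncated_dist (x i1) (x i2))).
  rewrite !big_ord_recl !big_ord0 -/i0 -/i1 -/i2 !truncated_distxx cos0.
  rewrite (truncated_distC (x i1) (x i0)) (truncated_distC (x i2) (x i0)).
  by rewrite (truncated_distC (x i2) (x i1)); ring.
split=> [/LAC_apexP lac x1 x2 x3 b1 b2 b3 b10 b20 b30|H].
  have := lac (fun i => nth x1 [:: x1; x2; x3] i) (fun i => nth b1 [:: b1; b2; b3] i).
  rewrite sum3/=; apply=> i.
  by case: i => -[|[|[|]]].
by apply/LAC_apexP => x b b0; rewrite sum3 H.
Qed.

Lemma perimeter_LAC3_apex : perimeter_le X (2 * pi) -> LAC 3 (apex o).
Proof.
move=> per; apply/LAC3_apexP => x1 x2 x3 b1 b2 b3 b10 b20 b30.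
(* [perimeter_le] only speaks of distinct points. When two coincide their weights add, and the form
   is at least [(b1 + b2 - b3) ^+ 2]. *)
have [->|/eqP n12] := eqVneq x1 x2.
  rewrite truncated_distxx cos0; have := cos_geN1 (truncated_dist x2 x3).
  have : 0 < (b1 + b2) * b3 by rewrite mulr_gt0// addr_gt0.
  have := sqr_ge0 (b1 + b2 - b3); nra.
have [->|/eqP n13] := eqVneq x1 x3.
  rewrite truncated_distxx cos0 (truncated_distC x2); have := cos_geN1 (truncated_dist x3 x2).
  have : 0 < (b1 + b3) * b2 by rewrite mulr_gt0// addr_gt0.
  have := sqr_ge0 (b1 + b3 - b2); nra.
have [->|/eqP n23] := eqVneq x2 x3.
  rewrite truncated_distxx cos0; have := cos_geN1 (truncated_dist x1 x3).
  have : 0 < (b2 + b3) * b1 by rewrite mulr_gt0// addr_gt0.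
  have := sqr_ge0 (b2 + b3 - b1); nra.
have perT : truncated_dist x1 x2 + truncated_dist x2 x3 + truncated_dist x1 x3 <= 2 * pi.
  have := per _ _ _ n12 n23 n13; rewrite (metric_sym x3).
  by apply: le_trans; rewrite !lerD// ge_min lexx orbT.
have /andP[a0 ap] := truncated_dist_itv x1 x2.
have /andP[b0 bp] := truncated_dist_itv x1 x3.
have /andP[c0 cp] := truncated_dist_itv x2 x3.
have cab := truncated_dist_triangle x2 x1 x3; rewrite (truncated_distC x2 x1) in cab.
set a := truncated_dist x1 x2 in perT a0 ap cab *.
set b := truncated_dist x1 x3 in perT b0 bp cab *.
set c := truncated_dist x2 x3 in perT c0 cp cab *.
(* For [a + b <= pi] this is the triangle inequality; otherwise the perimeter bound gives
   [c <= 2 * pi - (a + b) <= pi]. *)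
have cosc : cos (a + b) <= cos c.
  have [abp|pab] := leP (a + b) pi; first exact: ler_cos.
  by rewrite -cos2piB; apply: ler_cos; lra.
have bb0 : 0 <= b2 * b3 by rewrite mulr_ge0// ltW.
have := ler_wpM2l bb0 cosc; rewrite cosD => P.
(* |b1 + b2 e^(ia) + b3 e^(-ib)|^2 *)
have : 0 <= (b1 + b2 * cos a + b3 * cos b) ^+ 2 + (b2 * sin a - b3 * sin b) ^+ 2.
  by rewrite addr_ge0 ?sqr_ge0.
have -> : (b1 + b2 * cos a + b3 * cos b) ^+ 2 + (b2 * sin a - b3 * sin b) ^+ 2 =
  b1 ^+ 2 + b2 ^+ 2 * (cos a ^+ 2 + sin a ^+ 2) + b3 ^+ 2 * (cos b ^+ 2 + sin b ^+ 2)
  + 2 * (b1 * b2 * cos a + b1 * b3 * cos b + b2 * b3 * (cos a * cos b - sin a * sin b)) by ring.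
rewrite !cos2Dsin2; lra.
Qed.

(** * From the angle condition at the apex to the perimeter bound *)

Section perimeter.
Hypothesis lac : LAC 3 (apex o).

(** With weights 1, 1, [t] the form is [t ^+ 2 + 2 * t * s], where [s] is the sum of the two
    cosines; for [s < 0] the choice [t = - s] makes it [- s ^+ 2]. *)
Lemma LAC3_apex_antipodal x1 x2 x3 : pi <= mdist x1 x2 ->
  0 <= cos (truncated_dist x1 x3) + cos (truncated_dist x2 x3).
Proof.
move=> /min_idPl d12; rewrite leNgt; apply/negP.
set s := cos _ + cos _ => s0.
have ns0 : 0 < - s by rewrite oppr_gt0.
have := (LAC3_apexP.1 lac) x1 x2 x3 1 1 (- s) ltr01 ltr01 ns0.
have -> : cos (truncated_dist x1 x2) = - 1 by rewrite /truncated_dist d12 cospi.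
have := mulr_gt0 ns0 ns0; rewrite !mul1r !expr2.
have -> : - s * cos (truncated_dist x1 x3) = - s * s + s * cos (truncated_dist x2 x3).
  by rewrite /s; ring.
lra.
Qed.

(** If [x] and [y] were farther apart, the midpoint of a geodesic would be at distance more than
    [pi / 2] from both, with two negative cosines against [LAC3_apex_antipodal]. *)
Lemma LAC3_apex_mdist_le_pi : geodesic_space X -> forall x y, mdist x y <= pi.
Proof.
move=> geo x y; rewrite leNgt; apply/negP => d; have p0 := pi_gt0 R.
have [g [gg g0 g1]] := geo x y.
have h01 : 0 <= (1 / 2 : R) <= 1 by apply/andP; split; lra.
have dl : mdist x (g (1 / 2)) = mdist x y / 2.
  have := gg 0 (1 / 2); rewrite lexx ler01 g0 g1 => -> //.
  by rewrite sub0r normrN ger0_norm; lra.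
have dr : mdist y (g (1 / 2)) = mdist x y / 2.
  have := gg 1 (1 / 2); rewrite lexx ler01 g0 g1 => -> //.
  by rewrite ger0_norm; lra.
have := LAC3_apex_antipodal (g (1 / 2)) (ltW d).
rewrite /truncated_dist dl dr; set m := Num.min _ _.
have : cos m < cos (pi / 2).
  rewrite ltr_cos ?in_itv/= /m ?lt_min ?le_min ?ge_min ?lexx//; apply/andP; split; lra.
rewrite cos_pihalf; lra.
Qed.

Lemma LAC3_apex_perimeter : geodesic_space X -> perimeter_le X (2 * pi).
Proof.
move=> geo x1 x2 x3 n12 n23 n13; have dp := LAC3_apex_mdist_le_pi geo.
have tE x y : truncated_dist x y = mdist x y by apply/min_idPr/dp.
have dpos x y : x <> y -> 0 < mdist x y by move/eqP; rewrite mdist_gt0.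
rewrite (metric_sym x3); move: (dpos _ _ n12) (dpos _ _ n23) (dpos _ _ n13).
move: (dp x1 x2) (dp x2 x3) (dp x1 x3).
have := @LAC3_apex_antipodal x1 x2 x3; have := @LAC3_apex_antipodal x1 x3 x2.
have := (LAC3_apexP.1 lac) x1 x2 x3; rewrite !tE (metric_sym x3 x2).
set a := mdist x1 x2; set b := mdist x1 x3; set c := mdist x2 x3.
move=> H Hb Ha ap cp bp a0 c0 b0; rewrite leNgt; apply/negP => per.
have p0 := pi_gt0 R.
have opp (t u : R) : 0 < t <= pi -> 0 < u <= pi -> pi < t + u -> cos t + cos u < 0.
  move=> /andP[t0 tp] /andP[u0 up] tu.
  have : cos u < cos (pi - t) by rewrite ltr_cos ?in_itv/=; try apply/andP; lra.
  by rewrite cosB cospi sinpi; lra.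
(* When [a] or [b] equals [pi] a weight used below would vanish; there the antipodal inequality
   contradicts [opp]. *)
have [pa|a1] := leP pi a.
  by have := Ha pa; have := @opp b c; rewrite b0 bp c0 cp => /(_ isT isT); lra.
have [pb|b1] := leP pi b.
  by have := Hb pb; have := @opp a c; rewrite a0 ap c0 cp => /(_ isT isT); lra.
have abp : pi < a + b by lra.
have cosc : cos c < cos (a + b).
  by rewrite -(cos2piB (a + b)) ltr_cos ?in_itv/=; try apply/andP; lra.
have sa : 0 < sin a by apply: sin_gt0_pi; rewrite a0.
have sb : 0 < sin b by apply: sin_gt0_pi; rewrite b0.
have sab : 0 < - sin (a + b).
  rewrite -[a + b](subrK pi) sinDpi opprK; apply: sin_gt0_pi; apply/andP; split; lra.
(* the weights solve b1 + b2 e^(ia) + b3 e^(-ib) = 0 *)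
have := H _ _ _ sab sb sa.
have ss0 : 0 < sin b * sin a by rewrite mulr_gt0.
(* With [cos (a + b)] in place of [cos c] the form vanishes at these weights, so strictness makes it
   negative. *)
have : sin b * sin a * cos c < sin b * sin a * cos (a + b) by rewrite ltr_pM2l.
rewrite sinD cosD.
set p := cos a; set q := cos b; set u := sin a; set v := sin b.
have up : u ^+ 2 = 1 - p ^+ 2 by exact: sin2cos2.
have vq : v ^+ 2 = 1 - q ^+ 2 by exact: sin2cos2.
set w := v * u * cos c => w1.
suff : (- (u * q + p * v)) ^+ 2 + v ^+ 2 + u ^+ 2 + 2 * (- (u * q + p * v) * v * p
    + - (u * q + p * v) * u * q + v * u * (p * q - u * v)) = 0 by lra.
transitivity (v ^+ 2 * (1 - p ^+ 2 - u ^+ 2) + u ^+ 2 * (1 - q ^+ 2 - v ^+ 2)); first ring.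
by rewrite -up -vq !subrr !mulr0 addr0.
Qed.

End perimeter.
End apex.

Theorem theorem2p18 (R : realType) (X : metricType R) (o : X)
    (hX : geodesic_space X) (m : nat) :
  [/\ (forall (x0 : X) (r0 : {nonneg R}), 0 < r0%:num ->
         LAC m (cone_pt x0 r0) -> LAC m x0),
      (forall x0 : X, LAC m x0 ->
         forall r0 : {nonneg R}, 0 < r0%:num -> LAC m (cone_pt x0 r0)),
      (LAC 3 (apex o) <-> perimeter_le X (2 * pi))
    & ((diameter X <= (pi / 2)%:E)%E -> forall k : nat, LAC k (apex o))].
Proof.
split.
- by move=> x0 r0 r00; exact: LAC_base.
- by move=> x0 lac r0 r00; exact: LAC_cone.
- split; first by move=> lac; exact: (LAC3_apex_perimeter lac).
  exact: perimeter_LAC3_apex.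
- by move=> D k; exact: LAC_apex_diameter.
Qed.
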